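(* Let $M$ be a smooth manifold, $H$ a real closed 3-form, and let $(L_1,L_2)$ be the pair of complex Dirac structures (the $+i$-eigenbundles) defining a generalized Kähler structure on $M$, with underlying holomorphic Poisson structures $(I_\pm,\sigma_\pm)$. Let $\{F_t\in\Omega^2(M,\mathbb R)\}_{t\in\mathbb R}$ be a smooth family of real closed 2-forms with $F_0=0$ and such that $e^{F_t}L_{\sigma_+}$ is a family of holomorphic Poisson structures. Then the deformation $$(L_1'(t),L_2'(t))=(e^{iF_t}L_1,\ e^{-iF_t}L_2)$$ is generalized Kähler for $t$ sufficiently small, with corresponding holomorphic Poisson structures $$L'_{\sigma_+}(t)=e^{F_t}L_{\sigma_+},\qquad L'_{\sigma_-}(t)=L_{\sigma_-}.$$ Furthermore, if $\pi_1,\pi_2$ are the real Poisson structures underlying $L_1,L_2$, then this family is generalized Kähler in the maximal open interval containing $0$ in which both $(1+F_t\pi_1)$ and $(1+F_t\pi_2)$ are invertible.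
   Context: $T=TM$, $T_{\mathbb C}=TM\otimes\mathbb C$. $\langle\cdot,\cdot\rangle$ is the natural split-signature inner product $\langle X+\xi,Y+\eta\rangle=\tfrac12(\xi(Y)+\eta(X))$ on $T\oplus T^*$, extended complex-bilinearly. $H$-twisted Courant bracket: $[X+\xi,Y+\eta]_H=\mathcal L_X(Y+\eta)-i_Yd\xi+i_Yi_XH$. A complex Dirac structure for $H$ is a maximal isotropic subbundle of $T_{\mathbb C}\oplus T_{\mathbb C}^*$ involutive for $[\cdot,\cdot]_H$ (similarly real Dirac structures in $T\oplus T^*$). For a closed 2-form $B$ (real or complex), viewed as a map $BX=i_XB$, $e^B(X+\xi)=X+\xi+BX$; it maps Dirac structures to Dirac structures. Operations: $L+L'=\{X+\alpha+\beta : X+\alpha\in L,\ X+\beta\in L'\}$; $\lambda L=\{X+\lambda\alpha : X+\alpha\in L\}$ for a nonzero scalar $\lambda$; $L-L'=L+(-1)L'$. $\Gamma_\pi=\{\pi\xi+\xi:\xi\in T^*\}$ is the graph of a real Poisson structure $\pi$, viewed as a map $T^*\to T$; thus $1+F_t\pi_j$ is a bundle endomorphism of $T^*$. A holomorphic Poisson structure $(I,\sigma)$ is encoded by the complex Dirac structure (for zero 3-form) $L_\sigma=\{X+\sigma\zeta+\zeta : X\in T_{0,1},\ \zeta\in T^*_{1,0}\}$; saying that a complex Dirac structure is a holomorphic Poisson structure means that it has this form for some $(I,\sigma)$. A generalized complex structure is a complex structure $\mathbb J$ on $T\oplus T^*$ whose $+i$-eigenbundle is a complex Dirac structure for $H$.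 A generalized Kähler structure is a commuting pair $(\mathbb J_1,\mathbb J_2)$ of generalized complex structures with $\langle-\mathbb J_1\mathbb J_2u,u\rangle>0$ for all nonzero $u\in T\oplus T^*$. With $L_1,L_2$ the $+i$-eigenbundles, its underlying real Poisson structures $\pi_1,\pi_2$ are defined by $\Gamma_{\pi_j}=\tfrac1{2i}(L_j-\overline{L_j})$, and its underlying holomorphic Poisson structures $(I_\pm,\sigma_\pm)$ by $L_{\sigma_+}=\tfrac1{2i}(L_1-L_2)$ and $L_{\sigma_-}=\tfrac1{2i}(L_1-\overline{L_2})$; $L'_{\sigma_\pm}(t)$ denote the same expressions formed from $(L_1'(t),L_2'(t))$.
   Formalization: The condition ''1+F_tπ_2 invertible'' is corrected to ''1−F_tπ_2 invertible'' (the printed sign is false), and ''generalized Kähler for t sufficiently small'' is stated on an open neighborhood of each compact set (all of M if M is compact), as a uniform bound can fail on non-compact M. *)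

(* Defs.v *)
From HB Require Import structures.
From mathcomp Require Import all_boot all_order all_algebra.
From mathcomp Require Import complex.
From mathcomp Require Import all_classical all_reals all_analysis.

Set Implicit Arguments.
Unset Strict Implicit.
Unset Printing Implicit Defensive.

Import Order.TTheory GRing.Theory Num.Theory.
Import numFieldNormedType.Exports.

Local Open Scope classical_set_scope.
Local Open Scope ring_scope.

Section Euclidean.
Variable R : realType.
Local Notation C := (R[i]).

Definition pd {m} (f : 'rV[R]_m -> R) (i : 'I_m) : 'rV[R]_m -> R :=
  fun x => 'D_(delta_mx 0 i) f x.

(* C^oo on a neighbourhood of x: all iterated partial derivatives are
   (Frechet) differentiable there. *)
Definition smooth_at {m} (f : 'rV[R]_m -> R) (x : 'rV[R]_m) : Prop :=
  \forall y \near x, forall s : seq 'I_m,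
    differentiable (foldr (fun i g => pd g i) f s) y.

Definition pdC {m} (f : 'rV[R]_m -> C) (i : 'I_m) (x : 'rV[R]_m) : C :=
  Complex (pd (fun y => complex.Re (f y)) i x)
          (pd (fun y => complex.Im (f y)) i x).

Definition smoothC_at {m} (f : 'rV[R]_m -> C) (x : 'rV[R]_m) : Prop :=
  smooth_at (fun y => complex.Re (f y)) x /\
  smooth_at (fun y => complex.Im (f y)) x.

Definition smooth_mx_at {m a b} (f : 'rV[R]_m -> 'M[C]_(a, b)) x : Prop :=
  forall i j, smoothC_at (fun y => f y i j) x.

Definition cmx {a b} (A : 'M[R]_(a, b)) : 'M[C]_(a, b) :=
  map_mx (real_complex R) A.

Variable n : nat.
Implicit Types (X Y xi eta : 'rV[R]_n -> 'rV[C]_n) (x : 'rV[R]_n).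

Definition lie_vec X Y x : 'rV[C]_n :=
  \row_j \sum_i (X x 0 i * pdC (fun y => Y y 0 j) i x
               - Y x 0 i * pdC (fun y => X y 0 j) i x).

Definition lie_cov X eta x : 'rV[C]_n :=
  \row_j \sum_i (X x 0 i * pdC (fun y => eta y 0 j) i x
               + eta x 0 i * pdC (fun y => X y 0 i) j x).

Definition contract_d Y xi x : 'rV[C]_n :=
  \row_j \sum_i (Y x 0 i * (pdC (fun y => xi y 0 j) i x
                          - pdC (fun y => xi y 0 i) j x)).

End Euclidean.

(* A smooth n-manifold, presented by an atlas indexed by the points, the chart
   of index p being defined around p.  Every smooth structure is generated by
   such an atlas, and the choice does not affect the notions below.

   The chart of index p identifies T_pM, hence also T*_pM, with row vectors:
   fibres over p of all tensor bundles are described in that frame.  To take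
   derivatives at p, fields are first expressed in the single chart of index p
   (functions [loc_...] below), using the change of frame [trans]. *)
Record manifold (R : realType) (n : nat) := Manifold {
  carrier :> topologicalType ;
  carrier_hausdorff : hausdorff_space carrier ;
  carrier_countable : @second_countable carrier ;
  dom : carrier -> set carrier ;
  coord : carrier -> carrier -> 'rV[R]_n ;
  param : carrier -> 'rV[R]_n -> carrier ;
  dom_refl : forall p, dom p p ;
  dom_open : forall p, open (dom p) ;
  coord_open : forall p, open (coord p @` dom p) ;
  coordK : forall p q, dom p q -> param p (coord p q) = q ;
  coord_continuous : forall p q, dom p q -> {for q, continuous (coord p)} ;
  param_continuous : forall p q, dom p q ->
    {for coord p q, continuous (param p)} ;
  transition_smooth : forall p q r, dom p r -> dom q r ->
    forall k, smooth_at (fun x => coord q (param p x) 0 k) (coord p r) }.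

Section Geometry.
Variables (R : realType) (n : nat) (M : manifold R n).
Local Notation C := (R[i]).
Local Notation iC := ('i%C : C).

(* Matrix acting on row vectors of components of a tangent vector at r, from
   the chart of index p to the chart of index q; covectors change by
   (trans q p r)^T. *)
Definition trans (p q r : M) : 'M[R]_n :=
  jacobian (coord q \o param p) (coord p r).

Definition gtrans (p q r : M) : 'M[R]_(n + n) :=
  block_mx (trans p q r) 0 0 (trans q p r)^T.

Definition loc_vec (p : M) (X : M -> 'rV[C]_n) (x : 'rV[R]_n) : 'rV[C]_n :=
  let q := param p x in X q *m cmx (trans q p q).

(* endomorphism X |-> X *m A of T_C *)
Definition loc_end (p : M) (A : M -> 'M[C]_n) (x : 'rV[R]_n) : 'M[C]_n :=
  let q := param p x in cmx (trans p q q) *m A q *m cmx (trans q p q).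

(* bivector, as the map xi |-> xi *m P from T*_C to T_C *)
Definition loc_biv (p : M) (P : M -> 'M[C]_n) (x : 'rV[R]_n) : 'M[C]_n :=
  let q := param p x in cmx (trans q p q)^T *m P q *m cmx (trans q p q).

(* 2-form B(X, Y) = X *m B *m Y^T, so that i_X B = X *m B *)
Definition loc_form2 (p : M) (B : M -> 'M[R]_n) (x : 'rV[R]_n) : 'M[R]_n :=
  let q := param p x in trans p q q *m B q *m (trans p q q)^T.

Definition loc_form3 (p : M) (H : M -> 'I_n -> 'I_n -> 'I_n -> R)
    (x : 'rV[R]_n) (i j k : 'I_n) : R :=
  let q := param p x in let K := trans p q q in
  \sum_a \sum_b \sum_c K i a * K j b * K k c * H q a b c.

(* sections X + xi of T_C (+) T*_C are written row_mx X xi *)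
Definition loc_sec (p : M) (u : M -> 'rV[C]_(n + n)) (x : 'rV[R]_n) :
    'rV[C]_(n + n) :=
  let q := param p x in u q *m cmx (gtrans q p q).

Definition loc_gend (p : M) (J : M -> 'M[R]_(n + n)) (x : 'rV[R]_n) :
    'M[C]_(n + n) :=
  let q := param p x in cmx (gtrans p q q *m J q *m gtrans q p q).

Definition smooth_sec_at (u : M -> 'rV[C]_(n + n)) (p : M) : Prop :=
  smooth_mx_at (loc_sec p u) (coord p p).

Definition closed_form2 (B : M -> 'M[R]_n) : Prop :=
  forall p : M,
  [/\ (B p)^T = - B p,
      forall i j, smooth_at (fun x => loc_form2 p B x i j) (coord p p)
    & forall i j k,
        pd (fun x => loc_form2 p B x j k) i (coord p p)
      + pd (fun x => loc_form2 p B x k i) j (coord p p)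
      + pd (fun x => loc_form2 p B x i j) k (coord p p) = 0].

Definition closed_form3 (H : M -> 'I_n -> 'I_n -> 'I_n -> R) : Prop :=
  forall p : M,
  [/\ forall i j k, H p j i k = - H p i j k,
      forall i j k, H p i k j = - H p i j k,
      forall i j k, smooth_at (fun x => loc_form3 p H x i j k) (coord p p)
    & forall i j k l,
        pd (fun x => loc_form3 p H x j k l) i (coord p p)
      - pd (fun x => loc_form3 p H x i k l) j (coord p p)
      + pd (fun x => loc_form3 p H x i j l) k (coord p p)
      - pd (fun x => loc_form3 p H x i j k) l (coord p p) = 0].

(* smoothness is joint in time (first coordinate) and space *)
Definition smooth_family2 (F : R -> M -> 'M[R]_n) : Prop :=
  forall (t : R) (p : M) i j,
    smooth_at (fun z : 'rV[R]_(1 + n) =>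
                 loc_form2 p (F (lsubmx z 0 0)) (rsubmx z) i j)
              (row_mx t%:M (coord p p)).

Definition pairing {K : fieldType} (u v : 'rV[K]_(n + n)) : K :=
  2^-1 * ((rsubmx u *m (lsubmx v)^T) 0 0 + (rsubmx v *m (lsubmx u)^T) 0 0).

Definition courant (H : M -> 'I_n -> 'I_n -> 'I_n -> R)
    (u v : M -> 'rV[C]_(n + n)) (p : M) : 'rV[C]_(n + n) :=
  let x := coord p p in
  let X y := lsubmx (loc_sec p u y) in let xi y := rsubmx (loc_sec p u y) in
  let Y y := lsubmx (loc_sec p v y) in let eta y := rsubmx (loc_sec p v y) in
  row_mx (lie_vec X Y x)
    (lie_cov X eta x - contract_d Y xi x
     + \row_k \sum_i \sum_j
         X x 0 i * Y x 0 j * real_complex R (loc_form3 p H x i j k)).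

Definition isotropic (A : set 'rV[C]_(n + n)) : Prop :=
  forall u v, A u -> A v -> pairing u v = 0.

Definition maximal_isotropic (A : set 'rV[C]_(n + n)) : Prop :=
  isotropic A /\ forall B, isotropic B -> A `<=` B -> B `<=` A.

Definition bundle := M -> set 'rV[C]_(n + n).

(* smooth local frame around p, given by the rows of e *)
Definition subbundle_at (L : bundle) (p : M) : Prop :=
  exists (k : nat) (e : M -> 'M[C]_(k, n + n)),
    (forall i, smooth_sec_at (fun q => row i (e q)) p) /\
    \forall q \near p, row_free (e q) /\ L q = [set u | (u <= e q)%MS].

Definition involutive_at H (L : bundle) (p : M) : Prop :=
  forall u v, smooth_sec_at u p -> smooth_sec_at v p ->
    (\forall q \near p, L q (u q) /\ L q (v q)) -> L p (courant H u v p).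

Definition dirac_on (U : set M) H (L : bundle) : Prop :=
  forall p, U p ->
    [/\ subbundle_at L p, maximal_isotropic (L p) & involutive_at H L p].

Definition addD (L L' : bundle) : bundle := fun p =>
  [set u | exists X a b,
    [/\ u = row_mx X (a + b), L p (row_mx X a) & L' p (row_mx X b)]].

Definition scaleD (c : C) (L : bundle) : bundle := fun p =>
  [set u | exists X a, u = row_mx X (c *: a) /\ L p (row_mx X a)].

Definition subD (L L' : bundle) : bundle := addD L (scaleD (-1) L').

Definition conjD (L : bundle) : bundle := fun p =>
  [set map_mx (@conjc R) u | u in L p].

Definition expB (B : M -> 'M[C]_n) (L : bundle) : bundle := fun p =>
  [set u | exists X a, u = row_mx X (a + X *m B p) /\ L p (row_mx X a)].

(* smooth bivector with vanishing Schouten square *)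
Definition poisson (P : M -> 'M[C]_n) : Prop :=
  forall p : M,
  [/\ (P p)^T = - P p,
      smooth_mx_at (loc_biv p P) (coord p p)
    & forall i j k, let x := coord p p in let Q := loc_biv p P in
      \sum_l (Q x i l * pdC (fun y => Q y j k) l x
            + Q x j l * pdC (fun y => Q y k i) l x
            + Q x k l * pdC (fun y => Q y i j) l x) = 0].

Definition real_poisson (P : M -> 'M[R]_n) : Prop :=
  poisson (fun p => cmx (P p)).

(* complexification of the graph of P *)
Definition graphD (P : M -> 'M[R]_n) : bundle := fun p =>
  [set row_mx (xi *m cmx (P p)) xi | xi in [set: 'rV[C]_n]].

Definition T01 (I : M -> 'M[R]_n) (p : M) : set 'rV[C]_n :=
  [set X | X *m cmx (I p) = - iC *: X].

(* zeta o I = i zeta *)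
Definition Tstar10 (I : M -> 'M[R]_n) (p : M) : set 'rV[C]_n :=
  [set zeta | zeta *m (cmx (I p))^T = iC *: zeta].

Definition complex_structure (I : M -> 'M[R]_n) : Prop :=
  forall p : M,
  [/\ I p *m I p = - 1%:M,
      smooth_mx_at (loc_end p (fun q => cmx (I q))) (coord p p)
    & forall X Y : M -> 'rV[C]_n,
        smooth_mx_at (loc_vec p X) (coord p p) ->
        smooth_mx_at (loc_vec p Y) (coord p p) ->
        (\forall q \near p, T01 I q (X q) /\ T01 I q (Y q)) ->
        T01 I p (lie_vec (loc_vec p X) (loc_vec p Y) (coord p p))].

Definition dfun (f : M -> C) (p : M) : 'rV[C]_n :=
  \row_i pdC (f \o param p) i (coord p p).

Definition holomorphic_at (I : M -> 'M[R]_n) (f : M -> C) (p : M) : Prop :=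
  smoothC_at (f \o param p) (coord p p) /\
  \forall q \near p, Tstar10 I q (dfun f q).

(* s is a bivector of type (2,0), holomorphic in the sense that the bracket
   {f, g} = dg (s df) of local holomorphic functions is holomorphic *)
Definition holomorphic_poisson (I : M -> 'M[R]_n) (s : M -> 'M[C]_n) : Prop :=
  [/\ complex_structure I,
      poisson s,
      forall p, s p *m cmx (I p) = iC *: s p
    & forall p f g, holomorphic_at I f p -> holomorphic_at I g p ->
        holomorphic_at I
          (fun q => (dfun f q *m s q *m (dfun g q)^T) 0 0) p].

Definition L_hol (I : M -> 'M[R]_n) (s : M -> 'M[C]_n) : bundle := fun p =>
  [set u | exists X zeta, [/\ u = row_mx (X + zeta *m s p) zeta,
     T01 I p X & Tstar10 I p zeta]].

Definition is_holomorphic_poisson (L : bundle) : Prop :=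
  exists I s, holomorphic_poisson I s /\ L = L_hol I s.

Definition gen_complex_on (U : set M) H (J : M -> 'M[R]_(n + n))
    (L : bundle) : Prop :=
  [/\ forall p, U p -> J p *m J p = - 1%:M,
      forall p, U p -> smooth_mx_at (loc_gend p J) (coord p p),
      forall p, U p -> L p = [set u | u *m cmx (J p) = iC *: u]
    & dirac_on U H L].

Definition gen_kaehler_on (U : set M) H (L1 L2 : bundle) : Prop :=
  exists J1 J2,
  [/\ gen_complex_on U H J1 L1,
      gen_complex_on U H J2 L2,
      forall p, U p -> J1 p *m J2 p = J2 p *m J1 p
    & forall p, U p -> forall u : 'rV[R]_(n + n), u != 0 ->
        0 < pairing (- (u *m J2 p *m J1 p)) u].

Definition real_part (L : bundle) : bundle :=
  scaleD (2 * iC)^-1 (subD L (conjD L)).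

Definition sigma_plus (L1 L2 : bundle) : bundle :=
  scaleD (2 * iC)^-1 (subD L1 L2).

Definition sigma_minus (L1 L2 : bundle) : bundle :=
  scaleD (2 * iC)^-1 (subD L1 (conjD L2)).

Definition expF (F : M -> 'M[R]_n) : bundle -> bundle :=
  expB (fun p => cmx (F p)).

Definition def1 (F : M -> 'M[R]_n) : bundle -> bundle :=
  expB (fun p => iC *: cmx (F p)).

Definition def2 (F : M -> 'M[R]_n) : bundle -> bundle :=
  expB (fun p => - (iC *: cmx (F p))).

(* 1 + F P as an endomorphism xi |-> xi + F (P xi) of T* *)
Definition one_plus (F P : M -> 'M[R]_n) (p : M) : 'M[R]_n :=
  1%:M + P p *m F p.

(* Note the sign of the second factor: L1 is acted on by e^{iF} and L2 by
   e^{-iF}, so real_part (def1 F L1) is e^F applied to the graph of P1, and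
   real_part (def2 F L2) is e^{-F} applied to the graph of P2; these are graphs
   of bivectors exactly when 1 + F P1 and 1 - F P2 are invertible. *)
Definition one_plus_invertible (F P1 P2 : M -> 'M[R]_n) : Prop :=
  forall p, one_plus F P1 p \in unitmx /\
            one_plus (fun q => - F q) P2 p \in unitmx.

End Geometry.

(* maximal open interval containing 0 on which P holds
   (empty if there is no such interval) *)
Definition max_interval (R : realType) (P : R -> Prop) : set R :=
  [set t | exists a b : R, [/\ a < 0, 0 < b, a < t < b &
     forall s, a < s < b -> P s]].

(* Main.v *)
Require Import Defs.
From mathcomp Require Import all_boot all_order all_algebra.
From mathcomp Require Import complex zify ring lra.
From mathcomp Require Import all_classical all_reals all_analysis.
Import Order.TTheory GRing.Theory Num.Theory.
Import numFieldNormedType.Exports.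
Local Open Scope classical_set_scope.
Local Open Scope ring_scope.

(* With phi = [0 F; 0 0] acting on row vectors (X, xi), the eigenbundle L1 = ker(J1 - i)
   satisfies L1 (1 + i phi) = L1 a1 for the real matrix a1 = 1 + J1 phi, whose determinant
   is det(1 + F pi1).  So where 1 + F pi1 is invertible, e^{iF} L1 is the +i-eigenbundle of
   a1^-1 J1 a1; likewise for e^{-iF} L2 with a2 = 1 - J2 phi.  Shears by closed
   2-forms preserve the Courant bracket, hence involutivity.

   The formulas for sigma_+ and sigma_- are fibrewise algebra.  They lift T01(I'_+) into
   L1' n L2' and T01(I_-) into L1' n conj L2', and a dimension count shows that these two
   intersections span L1', so J1' and J2' commute.  The form <-J1'J2'u, u> is therefore
   symmetric and nondegenerate for every time in the interval, and being positive at time 0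
   it stays so.  For small times over a compact set, a1 and a2 are invertible because
   they equal 1 at time 0. *)

Set Implicit Arguments.
Unset Strict Implicit.
Unset Printing Implicit Defensive.

(** A row u of L1 satisfies i u = u J1, so u + i u phi = u (1 + J1 phi): on L1 the complex shear
    acts as a real matrix, and the deformed bundle is therefore the eigenbundle of a real
    endomorphism. The condition that a shear can break is the commutation of J1' and J2'. The
    hypothesis on e^F L_sigma_+ restores it: I'_+ squares to -1, so T01(I'_+) has dimension n/2, as
    has T01(I_-). Their lifts meet only in 0, because J2' is i on one and -i on the other, and L1'
    has dimension n. J1 and J2 are conjugated by different matrices a1 and a2, so conjugation alone
    does not carry positivity over; it is propagated in time, one fibre at a time. M may be
    noncompact, so small times are bounded over each compact set separately. *)

Section LocalDifferential.
Variables (R : realType) (V W : normedModType R).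
Implicit Types f g : V -> W.

(** The difference of the two functions is zero near [y], hence has zero differential there; adding
    it to [f] transfers differentiability and the value of the differential. *)
Lemma near_eq_diff f g (y : V) : (\forall x \near y, f x = g x) ->
  differentiable f y -> differentiable g y /\ 'd g y = 'd f y :> (V -> W).
Proof.
move=> fg df.
pose h : V -> W := g - f.
have h0 : h \o shift y = cst (h y) + (\0 : V -> W) +o_ (0 : V) id.
  apply/eqaddoP => e e0; near=> z.
  have -> : (h \o shift y - (cst (h y) + \0)) z = 0.
    rewrite !fctE /h /= !fctE addr0 (nbhs_singleton fg) subrr subr0.
    rewrite -(_ : f (z + y) = g (z + y)) ?subrr //.
    by near: z; move: fg; rewrite (near_shift 0 y) subr0.
  by rewrite normr0 mulr_ge0 // ltW.
have c0 : continuous (\0 : {linear V -> W}) by move=> ?; exact: cvg_cst.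
have dh0 := diff_unique c0 h0.
have dh : differentiable h y.
  by apply/diff_locallyP; rewrite dh0; split.
have -> : g = h + f by rewrite /h subrK.
split; first exact: differentiableD.
rewrite (diffD dh df).
apply/funext => z.
have dhz : 'd h y z = 0 by exact: (congr1 (fun k : V -> W => k z) dh0).
by rewrite -[LHS]/('d h y z + 'd f y z) dhz add0r.
Unshelve. all: by end_near. Qed.

End LocalDifferential.

(** * Smooth real functions, and their closure under sums, products and inverses *)

Section Smooth.
Variables (R : realType) (m : nat).
Local Notation V := 'rV[R]_m.
Implicit Types (f g : V -> R) (U : set V).

(** The open set is fixed once for all iterated derivatives, so inductions on the order of
    differentiation never shrink it. *)
Definition smooth_on U f := forall s y, U y ->
  differentiable (foldr (fun i g => pd g i) f s) y.

Lemma smooth_atP f x :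
  smooth_at f x <-> exists U, [/\ open U, U x & smooth_on U f].
Proof.
split=> [|[U [Uo Ux Uf]]].
  move=> /nbhs_interior hf.
  exists (interior (fun y => forall s, differentiable (foldr (fun i g => pd g i) f s) y)).
  split; [exact: open_interior|exact: nbhs_singleton hf|].
  by move=> s y /interior_subset; apply.
by apply: filterS (open_nbhs_nbhs (conj Uo Ux)) => y Uy s; exact: Uf.
Qed.

Lemma smooth_at_diff f x : smooth_at f x -> differentiable f x.
Proof. by move=> /nbhs_singleton /(_ [::]). Qed.

Lemma smooth_at_cont f x : smooth_at f x -> {for x, continuous f}.
Proof. by move=> /smooth_at_diff /differentiable_continuous. Qed.

Lemma pd_near f g y i : (\forall x \near y, f x = g x) -> pd f i y = pd g i y.
Proof. exact: near_eq_derive. Qed.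

Lemma open_eq_near U f g y : open U -> U y -> (forall x, U x -> f x = g x) ->
  \forall x \near y, f x = g x.
Proof. by move=> Uo Uy fg; apply: filterS (open_nbhs_nbhs (conj Uo Uy)). Qed.

(** Coinduction: every partial derivative of a member of [Q] is again a member up to equality on
    [U], so differentiating never leaves the class. Openness of [U] lets equality on [U] pass to the
    next derivative. *)
Lemma smooth_on_coind U (Q : (V -> R) -> Prop) : open U ->
  (forall f, Q f -> (forall y, U y -> differentiable f y) /\
     forall i, exists2 g, Q g & forall y, U y -> pd f i y = g y) ->
  forall f, Q f -> smooth_on U f.
Proof.
move=> Uo hQ f Qf s.
suff: exists2 g, Q g & forall y, U y -> foldr (fun i g => pd g i) f s y = g y.
  move=> [g Qg fg] y Uy; have [dg _] := hQ _ Qg.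
  apply: (near_eq_diff (f := g) _ (dg y Uy)).1.
  by apply: open_eq_near Uo Uy _ => x Ux; rewrite fg.
elim: s => [|i s [g Qg fg]] /=; first by exists f.
have [_ /(_ i) [g' Qg' gg']] := hQ _ Qg.
exists g' => // y Uy; rewrite -gg' //; apply: pd_near.
exact: open_eq_near Uo Uy fg.
Qed.

(** By the Leibniz and quotient rules this class is stable under partial derivatives, up to equality
    on [U]. It is the invariant of the coinduction and spares higher-order product formulas. *)
Inductive smooth_gen U : (V -> R) -> Prop :=
| sg_base f : smooth_on U f -> smooth_gen U f
| sg_add f g : smooth_gen U f -> smooth_gen U g -> smooth_gen U (f + g)
| sg_mul f g : smooth_gen U f -> smooth_gen U g -> smooth_gen U (f * g)
| sg_inv f : (forall y, U y -> f y != 0) -> smooth_gen U f ->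
    smooth_gen U (fun y => (f y)^-1).

Lemma smooth_on_cst U c : smooth_on U (cst c).
Proof.
move=> s y _; elim/last_ind: s c => [|s i IH] c /=.
  exact: differentiable_cst.
rewrite foldr_rcons.
by rewrite (_ : pd (cst c) i = cst 0) //; apply/funext => z; exact: derive_cst.
Qed.

Lemma smooth_on_pd U f i : smooth_on U f -> smooth_on U (pd f i).
Proof. by move=> fU s y Uy; have := fU (rcons s i) y Uy; rewrite foldr_rcons. Qed.

Lemma smooth_gen_diff U f y : smooth_gen U f -> U y -> differentiable f y.
Proof.
move=> + Uy; elim=> {f}.
- by move=> f /(_ [::] y Uy).
- by move=> f g _ df _ dg; exact: differentiableD.
- by move=> f g _ df _ dg; exact: differentiableM.
- by move=> f f0 _ df; apply: differentiableV => //; exact: f0.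
Qed.

Lemma smooth_gen_on U f : open U -> smooth_gen U f -> smooth_on U f.
Proof.
move=> Uo; apply: smooth_on_coind => // {}f gf; split.
  by move=> y Uy; exact: smooth_gen_diff gf Uy.
elim: gf => {f}.
- by move=> f fU i; exists (pd f i) => //; apply: sg_base; exact: smooth_on_pd.
- move=> f g gf IHf gg IHg i.
  have [f' gf' ff'] := IHf i; have [g' gg' hg'] := IHg i.
  exists (f' + g'); first exact: sg_add.
  move=> y Uy; rewrite /pd deriveD; [|exact/diff_derivable/smooth_gen_diff/Uy..].
  by rewrite fctE -(ff' y Uy) -(hg' y Uy).
- move=> f g gf IHf gg IHg i.
  have [f' gf' ff'] := IHf i; have [g' gg' hg'] := IHg i.
  exists (f * g' + g * f'); first by apply: sg_add; exact: sg_mul.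
  move=> y Uy; rewrite /pd deriveM; [|exact/diff_derivable/smooth_gen_diff/Uy..].
  by rewrite -[RHS]/(f y * g' y + g y * f' y) -(ff' y Uy) -(hg' y Uy).
- move=> f f0 gf IHf i.
  have [f' gf' ff'] := IHf i.
  (* This is -f'/f^2 written with the constructors, which include neither negation nor powers. *)
  exists (cst (-1) * ((fun y => (f y)^-1) * (fun y => (f y)^-1)) * f').
    apply: sg_mul => //; apply: sg_mul; first exact/sg_base/smooth_on_cst.
    by apply: sg_mul; exact: sg_inv.
  move=> y Uy; rewrite /pd deriveV ?f0 //; last exact/diff_derivable/smooth_gen_diff/Uy.
  rewrite -[RHS]/(-1 * ((f y)^-1 * (f y)^-1) * f' y) -(ff' y Uy).
  by rewrite mulN1r -invfM -expr2.
Qed.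

Lemma smooth_at_cst (c : R) (x : V) : smooth_at (cst c) x.
Proof. by apply/smooth_atP; exists setT; split=> //; [exact: openT|exact: smooth_on_cst]. Qed.

Lemma smooth_onS U U' f : U `<=` U' -> smooth_on U' f -> smooth_on U f.
Proof. by move=> UU' fU' s y /UU'; exact: fU'. Qed.

Lemma smooth_at_near f g x :
  (\forall y \near x, f y = g y) -> smooth_at f x -> smooth_at g x.
Proof.
move=> /nbhs_interior fg; apply: filterS2 (fg) => y /nbhs_interior Ay fy s.
have ext z s' : interior (fun y => f y = g y) z ->
    foldr (fun i g => pd g i) f s' z = foldr (fun i g => pd g i) g s' z.
  elim: s' z => [|i s' IH] z /=; first exact: interior_subset.
  move=> Az; apply: pd_near; apply: open_eq_near Az _ => //.
  exact: open_interior.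
apply: (near_eq_diff (f := foldr (fun i g => pd g i) f s) _ (fy s)).1.
by apply: filterS Ay => z Az; exact: ext.
Qed.

Lemma smooth_at_gen f x U : open U -> U x -> smooth_gen U f -> smooth_at f x.
Proof. by move=> Uo Ux Uf; apply/smooth_atP; exists U; split=> //; exact: smooth_gen_on. Qed.

Lemma smooth_at_gen2 f g x : smooth_at f x -> smooth_at g x -> exists U,
  [/\ open U, U x, smooth_gen U f & smooth_gen U g].
Proof.
move=> /smooth_atP [U [Uo Ux fU]] /smooth_atP [U' [U'o U'x gU']].
exists (U `&` U'); split; [exact: openI|by []| |].
- by apply/sg_base/smooth_onS/fU; exact: subIsetl.
- by apply/sg_base/smooth_onS/gU'; exact: subIsetr.
Qed.

Lemma smooth_atD f g x : smooth_at f x -> smooth_at g x ->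
  smooth_at (fun y => f y + g y) x.
Proof.
move=> hf /(smooth_at_gen2 hf) [U [Uo Ux fU gU]].
exact: smooth_at_gen Uo Ux (sg_add fU gU).
Qed.

Lemma smooth_atM f g x : smooth_at f x -> smooth_at g x ->
  smooth_at (fun y => f y * g y) x.
Proof.
move=> hf /(smooth_at_gen2 hf) [U [Uo Ux fU gU]].
exact: smooth_at_gen Uo Ux (sg_mul fU gU).
Qed.

Lemma smooth_atV f x : f x != 0 -> smooth_at f x ->
  smooth_at (fun y => (f y)^-1) x.
Proof.
move=> fx0 hf; have /smooth_at_cont fc := hf.
move: hf => /smooth_atP [U [Uo Ux fU]].
have : \forall y \near x, f y != 0.
  have := fc [set z | z != 0]; apply.
  by apply: open_nbhs_nbhs; split=> //; exact: open_neq.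
move=> /nbhs_interior Ax; set A := interior _ in Ax.
apply: (@smooth_at_gen _ _ (U `&` A)).
- by apply: openI => //; exact: open_interior.
- by split=> //; exact: nbhs_singleton Ax.
apply: sg_inv => [y [_ /interior_subset //]|].
by apply/sg_base/smooth_onS/fU; exact: subIsetl.
Qed.

End Smooth.

(** * Matrices with entries in an algebra of functions *)

Section FunctionAlgebra.
Variables (T : Type) (K : fieldType) (P : (T -> K) -> Prop).

(** Applied to real smoothness, complex smoothness and continuity at a point, so that each matrix
    construction is treated once for all three. *)
Definition fun_subring := [/\ forall c, P (fun=> c),
  forall f g, P f -> P g -> P (fun x => f x + g x) &
  forall f g, P f -> P g -> P (fun x => f x * g x)].

Definition mx_fun a b (A : T -> 'M[K]_(a, b)) := forall i j, P (fun x => A x i j).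

Hypothesis hP : fun_subring.

Lemma fun_subring_sum I (r : seq I) (Q : pred I) (f : I -> T -> K) :
  (forall i, P (f i)) -> P (fun x => \sum_(i <- r | Q i) f i x).
Proof.
have [Pc PD _] := hP; move=> Pf; elim: r => [|i r IH].
  by rewrite (_ : (fun _ => _) = fun=> 0) //; apply/funext => x; rewrite big_nil.
have [Qi|Qi] := boolP (Q i).
  rewrite (_ : (fun _ => _) = fun x => f i x + \sum_(j <- r | Q j) f j x); first exact: PD.
  by apply/funext => x; rewrite big_cons Qi.
rewrite (_ : (fun _ => _) = fun x => \sum_(j <- r | Q j) f j x) //.
by apply/funext => x; rewrite big_cons (negbTE Qi).
Qed.

Lemma fun_subring_prod I (r : seq I) (Q : pred I) (f : I -> T -> K) :
  (forall i, P (f i)) -> P (fun x => \prod_(i <- r | Q i) f i x).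
Proof.
have [Pc _ PM] := hP; move=> Pf; elim: r => [|i r IH].
  by rewrite (_ : (fun _ => _) = fun=> 1) //; apply/funext => x; rewrite big_nil.
have [Qi|Qi] := boolP (Q i).
  rewrite (_ : (fun _ => _) = fun x => f i x * \prod_(j <- r | Q j) f j x); first exact: PM.
  by apply/funext => x; rewrite big_cons Qi.
rewrite (_ : (fun _ => _) = fun x => \prod_(j <- r | Q j) f j x) //.
by apply/funext => x; rewrite big_cons (negbTE Qi).
Qed.

Lemma fun_subring_det n (A : T -> 'M[K]_n) : mx_fun A -> P (fun x => \det (A x)).
Proof.
have [Pc _ PM] := hP; move=> hA.
apply: fun_subring_sum => s; apply: PM => //.
by apply: fun_subring_prod => i; exact: hA.
Qed.

Lemma mx_fun_cst a b (A : 'M[K]_(a, b)) : mx_fun (fun=> A).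
Proof. by have [Pc _ _] := hP; move=> i j; exact: Pc. Qed.

Lemma mx_funD a b (A B : T -> 'M[K]_(a, b)) :
  mx_fun A -> mx_fun B -> mx_fun (fun x => A x + B x).
Proof.
have [_ PD _] := hP; move=> hA hB i j.
by under eq_fun do rewrite mxE; exact: PD.
Qed.

Lemma mx_funZ a b (f : T -> K) (A : T -> 'M[K]_(a, b)) :
  P f -> mx_fun A -> mx_fun (fun x => f x *: A x).
Proof.
have [_ _ PM] := hP; move=> hf hA i j.
by under eq_fun do rewrite mxE; exact: PM.
Qed.

Lemma mx_funN a b (A : T -> 'M[K]_(a, b)) :
  mx_fun A -> mx_fun (fun x => - A x).
Proof.
have [Pc _ _] := hP; move=> hA.
by under eq_fun do rewrite -scaleN1r; exact: mx_funZ.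
Qed.

Lemma mx_funM a b c (A : T -> 'M[K]_(a, b)) (B : T -> 'M[K]_(b, c)) :
  mx_fun A -> mx_fun B -> mx_fun (fun x => A x *m B x).
Proof.
have [_ _ PM] := hP; move=> hA hB i j; under eq_fun do rewrite mxE.
by apply: fun_subring_sum => k; exact: PM.
Qed.

Lemma mx_fun_tr a b (A : T -> 'M[K]_(a, b)) :
  mx_fun A -> mx_fun (fun x => (A x)^T).
Proof. by move=> hA i j; under eq_fun do rewrite mxE; exact: hA. Qed.

Lemma mx_fun_block a b c d (A : T -> 'M[K]_(a, c)) (B : T -> 'M[K]_(a, d))
    (C : T -> 'M[K]_(b, c)) (D : T -> 'M[K]_(b, d)) :
  mx_fun A -> mx_fun B -> mx_fun C -> mx_fun D ->
  mx_fun (fun x => block_mx (A x) (B x) (C x) (D x)).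
Proof.
move=> hA hB hC hD i j; under eq_fun do rewrite !mxE.
case: (fintype.split i) => i'; under eq_fun do rewrite mxE; by case: (fintype.split j).
Qed.

(* Unlike [invmx], given by a single formula (with value 0 at singular matrices),
   so that smoothness of A gives smoothness of [adjinv A]. *)
Definition adjinv n (A : 'M[K]_n) : 'M[K]_n := (\det A)^-1 *: \adj A.

(** By Cramer's rule only the inverse of the determinant leaves the ring operations, so one
    nonvanishing condition at [x0] suffices. *)
Lemma mx_fun_inv n (A : T -> 'M[K]_n) (x0 : T) :
  (forall f, f x0 != 0 -> P f -> P (fun x => (f x)^-1)) ->
  A x0 \in unitmx -> mx_fun A -> mx_fun (fun x => adjinv (A x)).
Proof.
have [Pc PD PM] := hP; move=> PV uA hA; apply: mx_funZ.
  apply: PV; last exact: fun_subring_det.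
  by move: uA; rewrite unitmxE unitfE.
move=> i j; under eq_fun do rewrite mxE; apply: PM => //.
by apply: fun_subring_det => k l; under eq_fun do rewrite !mxE; exact: hA.
Qed.

End FunctionAlgebra.

Lemma adjinvE (K : fieldType) n (A : 'M[K]_n) :
  A \in unitmx -> adjinv A = invmx A.
Proof. by rewrite /adjinv /invmx => ->. Qed.

(** * Complex-valued smooth functions and their partial derivatives *)

Section SmoothAlgebra.
Variables (R : realType) (m : nat).
Local Notation V := 'rV[R]_m.
Local Notation C := (R[i]).

Lemma smooth_at_subring (x : V) : fun_subring (fun f : V -> R => smooth_at f x).
Proof.
split=> [c|f g|f g]; [exact: (smooth_at_cst c x)|exact: smooth_atD|exact: smooth_atM].
Qed.

Lemma continuous_subring (T : topologicalType) (x : T) :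
  fun_subring (fun f : T -> R => {for x, continuous f}).
Proof.
split=> [c|f g hf hg|f g hf hg]; [exact: cst_continuous|exact: continuousD|].
exact: continuousM.
Qed.

Lemma ReM (a b : C) :
  complex.Re (a * b) = complex.Re a * complex.Re b - complex.Im a * complex.Im b.
Proof. by case: a b => ? ? []. Qed.

Lemma ImM (a b : C) :
  complex.Im (a * b) = complex.Re a * complex.Im b + complex.Im a * complex.Re b.
Proof. by case: a b => ? ? []. Qed.

Lemma ReD (a b : C) : complex.Re (a + b) = complex.Re a + complex.Re b.
Proof. by case: a b => ? ? []. Qed.

Lemma ImD (a b : C) : complex.Im (a + b) = complex.Im a + complex.Im b.
Proof. by case: a b => ? ? []. Qed.

Lemma smoothC_at_subring (x : V) : fun_subring (fun f : V -> C => smoothC_at f x).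
Proof.
have [Pc PD PM] := smooth_at_subring x.
split=> [c|f g [f1 f2] [g1 g2]|f g [f1 f2] [g1 g2]]; first by split; exact: Pc.
- by split; [under eq_fun do rewrite ReD|under eq_fun do rewrite ImD]; exact: PD.
- split; [under eq_fun do rewrite ReM -mulN1r|under eq_fun do rewrite ImM].
    by apply: PD; [exact: PM|apply: (PM (fun=> _)) => //; exact: PM].
  by apply: PD; exact: PM.
Qed.

Lemma smoothC_at_near (f g : V -> C) x :
  (\forall y \near x, f y = g y) -> smoothC_at f x -> smoothC_at g x.
Proof.
move=> fg [h1 h2]; split.
  by apply: smooth_at_near h1; apply: filterS fg => y ->.
by apply: smooth_at_near h2; apply: filterS fg => y ->.
Qed.

Lemma smooth_mx_at_near a b (f g : V -> 'M[C]_(a, b)) x :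
  (\forall y \near x, f y = g y) -> smooth_mx_at f x -> smooth_mx_at g x.
Proof.
move=> fg h i j; apply: smoothC_at_near (h i j).
by apply: filterS fg => y ->.
Qed.

Lemma smooth_mx_at_cmx a b (f : V -> 'M[R]_(a, b)) x :
  smooth_mx_at (fun y => cmx (f y)) x <-> forall i j, smooth_at (fun y => f y i j) x.
Proof.
split=> h i j; have := h i j.
  by move=> [h1 _]; under eq_fun do rewrite -[f _ i j]/(complex.Re (real_complex R (f _ i j)));
    move: h1; under eq_fun do rewrite mxE.
move=> hij; split; under eq_fun do rewrite mxE //=; first exact: hij.
exact: smooth_at_cst.
Qed.

Implicit Types f g : V -> C.

Lemma pdC_near f g y i : (\forall x \near y, f x = g x) -> pdC f i y = pdC g i y.
Proof.
by move=> fg; rewrite /pdC; congr Complex; apply: pd_near; apply: filterS fg => z ->.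
Qed.

Lemma eq_pd (f g : V -> R) i x : f =1 g -> pd f i x = pd g i x.
Proof. by move=> /funext ->. Qed.

Lemma pdD (f g : V -> R) i x : smooth_at f x -> smooth_at g x ->
  pd (fun y => f y + g y) i x = pd f i x + pd g i x.
Proof.
move=> /smooth_at_diff df /smooth_at_diff dg.
exact: (deriveD (diff_derivable df) (diff_derivable dg)).
Qed.

Lemma pdM (f g : V -> R) i x : smooth_at f x -> smooth_at g x ->
  pd (fun y => f y * g y) i x = f x * pd g i x + g x * pd f i x.
Proof.
move=> /smooth_at_diff df /smooth_at_diff dg.
exact: (deriveM (diff_derivable df) (diff_derivable dg)).
Qed.

Lemma pd_cst (c : R) i (x : V) : pd (fun=> c) i x = 0.
Proof. exact: derive_cst. Qed.

Lemma pdCD f g i x : smoothC_at f x -> smoothC_at g x ->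
  pdC (fun y => f y + g y) i x = pdC f i x + pdC g i x.
Proof.
move=> [f1 f2] [g1 g2].
rewrite /pdC (eq_pd i x (fun y => ReD (f y) (g y))) (eq_pd i x (fun y => ImD (f y) (g y))).
by rewrite (pdD i f1 g1) (pdD i f2 g2).
Qed.

Lemma pdCM f g i x : smoothC_at f x -> smoothC_at g x ->
  pdC (fun y => f y * g y) i x = f x * pdC g i x + pdC f i x * g x.
Proof.
move=> [f1 f2] [g1 g2]; have [Pc _ PM] := smooth_at_subring x.
(* The difference is written with a factor -1 so that the sum, product and constant rules of [pd]
   cover it. *)
have e y : complex.Re (f y * g y) =
    complex.Re (f y) * complex.Re (g y) + -1 * (complex.Im (f y) * complex.Im (g y)).
  by rewrite ReM mulN1r.
rewrite /pdC (eq_pd i x e) (eq_pd i x (fun y => ImM (f y) (g y))).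
rewrite (pdD i (PM _ _ f1 g1) (PM _ _ (Pc (-1)) (PM _ _ f2 g2))).
rewrite (pdD i (PM _ _ f1 g2) (PM _ _ f2 g1)).
rewrite (pdM i (Pc (-1)) (PM _ _ f2 g2)) (pdM i f1 g1) (pdM i f2 g2).
rewrite (pdM i f1 g2) (pdM i f2 g1) pd_cst.
case: (f x) => a b; case: (g x) => c d /=.
rewrite -[RHS]/(Complex (a * _ - b * _ + (_ * c - _ * d)) (a * _ + b * _ + (_ * d + _ * c))).
by congr Complex; ring.
Qed.

Lemma pdC_cst (c : C) i (x : V) : pdC (fun=> c) i x = 0.
Proof. by rewrite /pdC !pd_cst. Qed.

Lemma pdC_sum n (f : 'I_n -> V -> C) i x : (forall k, smoothC_at (f k) x) ->
  pdC (fun y => \sum_k f k y) i x = \sum_k pdC (f k) i x.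
Proof.
move=> hf; have hs r : smoothC_at (fun y => \sum_(k <- r) f k y) x.
  by apply: (fun_subring_sum (smoothC_at_subring x)).
elim: (index_enum _) => [|k r IH].
  by rewrite big_nil (_ : (fun _ => _) = fun=> 0) ?pdC_cst //; apply/funext => y; rewrite big_nil.
rewrite big_cons -IH -(pdCD i (hf k) (hs r)).
rewrite (_ : (fun y => \sum_(j <- k :: r) f j y) = fun y => f k y + \sum_(j <- r) f j y) //.
by apply/funext => y; rewrite big_cons.
Qed.

Lemma pdC_real (f : V -> R) i x : pdC (fun y => real_complex R (f y)) i x =
  real_complex R (pd f i x).
Proof. by rewrite /pdC /= pd_cst. Qed.

End SmoothAlgebra.

(** * Complexified real matrices and the dimensions of their eigenspaces *)

Section Complexification.
Variable R : realType.
Local Notation C := (R[i]).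
Local Notation iC := ('i%C : C).

Lemma cmxM a b c (A : 'M[R]_(a, b)) (B : 'M[R]_(b, c)) : cmx (A *m B) = cmx A *m cmx B.
Proof. exact: map_mxM. Qed.

Lemma cmxD a b (A B : 'M[R]_(a, b)) : cmx (A + B) = cmx A + cmx B.
Proof. exact: map_mxD. Qed.

Lemma cmxN a b (A : 'M[R]_(a, b)) : cmx (- A) = - cmx A.
Proof. exact: map_mxN. Qed.

Lemma cmx1 a : cmx (1%:M : 'M[R]_a) = 1%:M.
Proof. exact: map_mx1. Qed.

Lemma cmx0 a b : cmx (0 : 'M[R]_(a, b)) = 0.
Proof. exact: map_mx0. Qed.

Lemma cmx_tr a b (A : 'M[R]_(a, b)) : cmx A^T = (cmx A)^T.
Proof. by rewrite /cmx map_trmx. Qed.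

Lemma cmx_block a b c d (A : 'M[R]_(a, c)) (B : 'M[R]_(a, d)) C0 (D : 'M[R]_(b, d)) :
  cmx (block_mx A B C0 D) = block_mx (cmx A) (cmx B) (cmx C0) (cmx D).
Proof. exact: map_block_mx. Qed.

Lemma cmx_inj a b : injective (@cmx R a b).
Proof. by apply: map_mx_inj. Qed.

Lemma sqr_iC : iC * iC = -1.
Proof. by rewrite -expr2 sqr_i. Qed.

Lemma iC_neq0 : iC != 0.
Proof.
apply/eqP => h; move: sqr_iC; rewrite h mul0r => /eqP.
by rewrite eq_sym oppr_eq0 oner_eq0.
Qed.

Lemma cmx_ReIm a b (A B : 'M[R]_(a, b)) : cmx A + iC *: cmx B = 0 -> A = 0 /\ B = 0.
Proof.
move=> h; suff e i j : A i j = 0 /\ B i j = 0.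
  by split; apply/matrixP => i j; have [e1 e2] := e i j; rewrite mxE.
move: h => /matrixP /(_ i j); rewrite !mxE.
rewrite -[LHS]/(Complex (A i j + (0 * B i j - 1 * 0)) (0 + (0 * 0 + 1 * B i j))).
by move=> /eqP; rewrite eq_complex /= => /andP [/eqP h1 /eqP h2]; split; lra.
Qed.

Definition conjm a b (A : 'M[C]_(a, b)) : 'M[C]_(a, b) := map_mx (@conjc R) A.

Lemma conjm_cmx a b (A : 'M[R]_(a, b)) : conjm (cmx A) = cmx A.
Proof. by apply/matrixP => i j; rewrite !mxE /= oppr0. Qed.

Lemma conjmM a b c (A : 'M[C]_(a, b)) (B : 'M[C]_(b, c)) :
  conjm (A *m B) = conjm A *m conjm B.
Proof. exact: map_mxM. Qed.

Lemma conjmD a b (A B : 'M[C]_(a, b)) : conjm (A + B) = conjm A + conjm B.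
Proof. exact: map_mxD. Qed.

Lemma conjmZ a b c (A : 'M[C]_(a, b)) : conjm (c *: A) = conjc c *: conjm A.
Proof. exact: map_mxZ. Qed.

Lemma conjmK a b : involutive (@conjm a b).
Proof. by move=> A; apply/matrixP => i j; rewrite !mxE conjcK. Qed.

Lemma conj_iC : conjc iC = - iC.
Proof. by apply/eqP; rewrite eq_complex /= oppr0 !eqxx. Qed.

Lemma eigen_conj a m (J : 'M[R]_m) (c : C) (A : 'M[C]_(a, m)) :
  A *m cmx J = c *: A -> conjm A *m cmx J = conjc c *: conjm A.
Proof. by move=> h; rewrite -[cmx J]conjm_cmx -conjmM h conjmZ. Qed.

(** Up to the factor 2i, J + i is the projection onto the +i-eigenspace, so its rows supply enough
    eigenvectors to test identities. *)
Lemma eigen_addi m (J : 'M[R]_m) : J *m J = - 1%:M ->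
  (cmx J + iC%:M) *m cmx J = iC *: (cmx J + iC%:M).
Proof.
move=> J2; rewrite mulmxDl -cmxM J2 cmxN cmx1 mul_scalar_mx scalerDr addrC.
by rewrite scale_scalar_mx sqr_iC raddfN.
Qed.

Lemma rank_eigenspace m (A : 'M[C]_m) (c : C) :
  \rank (eigenspace A c) = (m - \rank (A - c%:M)%R)%N.
Proof. exact: (mxrank_ker (A - c%:M)). Qed.

(** Complex conjugation fixes the real matrix J and exchanges its two eigenspaces. *)
Lemma rank_eigen_conj m (J : 'M[R]_m) :
  \rank (eigenspace (cmx J) iC) = \rank (eigenspace (cmx J) (- iC)).
Proof.
suff e : \rank (cmx J - iC%:M) = \rank (cmx J - (- iC)%:M).
  exact: etrans (rank_eigenspace _ _) (etrans (congr1 (subn m) e) (esym (rank_eigenspace _ _))).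
rewrite -(mxrank_map (@conjc R)) map_mxB map_scalar_mx -/(conjm _) conjm_cmx.
by rewrite -conj_iC.
Qed.

(** J - i and J + i multiply to 0 and differ by the invertible scalar 2i, so their ranks add up to
    m; conjugation makes the two eigenspaces equidimensional. *)
Lemma rank_eigen m (J : 'M[R]_m) : J *m J = - 1%:M ->
  (2 * \rank (eigenspace (cmx J) iC))%N = m.
Proof.
move=> J2.
have arith r r' a b : r = r' -> r' = (m - b)%N -> r = (m - a)%N ->
  (a + b <= m)%N -> (m <= a + b)%N -> (a <= m)%N -> (b <= m)%N -> (2 * r)%N = m by lia.
set A := cmx J - iC%:M; set B := cmx J - (- iC)%:M.
have AB : A *m B = 0.
  rewrite /A /B mulmxBl !mulmxBr -cmxM J2 cmxN cmx1 mul_mx_scalar !mul_scalar_mx.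
  rewrite scale_scalar_mx mulrN sqr_iC opprK scaleNr opprD !opprK.
  by rewrite addrA addrK addNr.
have r1 : (\rank A + \rank B <= m)%N by exact: mulmx0_rank_max AB.
have r2 : (m <= \rank A + \rank B)%N.
  have e : (2 * iC) *: 1%:M = B - A.
    rewrite /A /B opprB addrC addrA subrK raddfN opprK -raddfD /= scalemx1.
    by rewrite mulr_natl mulr2n.
  have u : \rank ((2 * iC) *: 1%:M : 'M[C]_m) = m.
    rewrite mxrank_scale_nz ?mxrank1 // mulf_neq0 ?iC_neq0 //.
  have := leq_trans (eq_leq (congr1 (fun X => \rank X) e)) (mxrank_add B (- A)).
  by rewrite u (mxrank_opp A) addnC.
have a1 : (\rank A <= m)%N by exact: rank_leq_row.
have b1 : (\rank B <= m)%N by exact: rank_leq_row.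
exact: (arith _ _ _ _ (rank_eigen_conj J) (rank_eigenspace _ _)
  (rank_eigenspace _ _) r1 r2 a1 b1).
Qed.

(* Both J1 and J2 are diagonalized by the rows of U and V and their
   conjugates. *)
Lemma commute_rank m k l (J1 J2 : 'M[R]_m) (U : 'M[C]_(k, m)) (V : 'M[C]_(l, m)) :
  J1 *m J1 = - 1%:M ->
  U *m cmx J1 = iC *: U -> U *m cmx J2 = iC *: U ->
  V *m cmx J1 = iC *: V -> V *m cmx J2 = - iC *: V ->
  (m <= 2 * (\rank U + \rank V))%N -> J1 *m J2 = J2 *m J1.
Proof.
move=> J11 U1 U2 V1 V2 r.
(* On the intersection J2 acts both as i and as -i. *)
have cap : \rank (U :&: V)%MS = 0%N.
  apply/eqP; rewrite mxrank_eq0; apply/eqP.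
  have [A hA] := submxP (capmxSl U V); have [B hB] := submxP (capmxSr U V).
  have e1 : (U :&: V)%MS *m cmx J2 = iC *: (U :&: V)%MS.
    by rewrite {1}hA -mulmxA U2 -scalemxAr -hA.
  have e2 : (U :&: V)%MS *m cmx J2 = - iC *: (U :&: V)%MS.
    by rewrite {1}hB -mulmxA V2 -scalemxAr -hB.
  move: e1; rewrite e2 scaleNr => /eqP; rewrite eq_sym -addr_eq0 -scalerDl scaler_eq0.
  by rewrite -mulr2n mulrn_eq0 /= (negbTE iC_neq0) => /eqP.
set E := eigenspace (cmx J1) iC.
have UE : (U + V <= E)%MS.
  by rewrite addsmx_sub; apply/andP; split; apply/eigenspaceP.
(* The eigenspace has dimension m/2, which [U + V] already attains. *)
have EU : (E <= U + V)%MS.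
  rewrite -(geq_leqif (mxrank_leqif_sup UE)).
  have := mxrank_sum_cap U V; rewrite cap addn0 => ->.
  have arith a b c : (m <= 2 * (a + b))%N -> (2 * c)%N = m -> (c <= a + b)%N by lia.
  exact: arith r (rank_eigen J11).
pose D := cmx J1 *m cmx J2 - cmx J2 *m cmx J1.
have UD : U *m D = 0.
  by rewrite mulmxBr !mulmxA U1 U2 -!scalemxAl U1 U2 subrr.
have VD : V *m D = 0.
  by rewrite mulmxBr !mulmxA V1 V2 -!scalemxAl V1 V2 !scalerA mulrC subrr.
have hE : ((cmx J1 + iC%:M)%R <= U + V)%MS.
  apply: (submx_trans _ EU).
  apply/eigenspaceP.
  exact: (eigen_addi J11).
have [[A B] /= hAB] := sub_addsmxP hE.
(* The commutator D is real, so the imaginary part of (J1 + i) D = 0 is D = 0. *)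
have : (cmx J1 + iC%:M) *m D = 0.
  by rewrite hAB mulmxDl -!mulmxA UD VD !mulmx0 addr0.
rewrite /D -!cmxM -cmxN -cmxD mulmxDl -cmxM mul_scalar_mx => /cmx_ReIm [_ /eqP].
by rewrite subr_eq0 => /eqP.
Qed.

(* Counts dimensions through the projection to the tangent space. *)
Lemma rank_lift n (I : 'M[R]_n) (W : 'M[C]_(n + n)) : I *m I = - 1%:M ->
  (forall X : 'rV[C]_n, X *m cmx I = - iC *: X ->
     exists xi, (row_mx X xi <= W)%MS) ->
  (n <= 2 * \rank W)%N.
Proof.
move=> I2 hW; pose E := eigenspace (cmx I) (- iC).
pose P : 'M[C]_(n + n, n) := col_mx 1%:M 0.
have EW : (E <= W *m P)%MS.
  apply/row_subP => i; have [] := hW (row i E).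
    by apply/eigenspaceP; exact: row_sub.
  move=> xi /(submxMr P); rewrite /P mul_row_col mulmx1 mulmx0 addr0.
  by [].
have arith r r' w v : (2 * r)%N = n -> r = r' -> (r' <= w)%N -> (w <= v)%N ->
  (n <= 2 * v)%N by lia.
exact: (arith _ _ _ _ (rank_eigen I2) (rank_eigen_conj I) (mxrankS EW) (mxrankM_maxl W P)).
Qed.

End Complexification.

(** * Linear algebra of one fibre of T + T*, acting on row vectors *)

Section Pointwise.
Variables (R : realType) (n : nat).
Local Notation C := (R[i]).
Local Notation iC := ('i%C : C).

(** Gram matrix of twice the pairing. *)
Definition pairing_mx (K : fieldType) : 'M[K]_(n + n) := block_mx 0 1%:M 1%:M 0.

Lemma pairing_mxE (K : fieldType) (u v : 'rV[K]_(n + n)) :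
  pairing u v = 2^-1 * (u *m pairing_mx K *m v^T) 0 0.
Proof.
rewrite /pairing -{3}[u]hsubmxK /pairing_mx mul_row_block !mulmx0 !mulmx1 add0r addr0.
rewrite -{3}[v]hsubmxK tr_row_mx mul_row_col [in RHS]mxE.
congr (_ * (_ + _)).
by rewrite -[in LHS](trmxK (rsubmx v)) -trmx_mul mxE.
Qed.

Lemma pairing_mx_tr (K : fieldType) : (pairing_mx K)^T = pairing_mx K.
Proof. by rewrite /pairing_mx tr_block_mx !trmx0 trmx1. Qed.

Lemma pairing_mx_sqr (K : fieldType) : pairing_mx K *m pairing_mx K = 1%:M.
Proof.
by rewrite mulmx_block !mul0mx !mulmx0 !mulmx1 !addr0 !add0r -scalar_mx_block.
Qed.

Lemma cmx_pairing_mx : cmx (pairing_mx R) = pairing_mx C.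
Proof. by rewrite cmx_block cmx0 cmx1. Qed.

(** The transformation e^B of row vectors X + xi, acting from the right. *)
Definition shear (K : fieldType) (B : 'M[K]_n) : 'M[K]_(n + n) := block_mx 1%:M B 0 1%:M.

Lemma shearE (K : fieldType) (B : 'M[K]_n) k (X a : 'M[K]_(k, n)) :
  row_mx X a *m shear B = row_mx X (a + X *m B).
Proof. by rewrite mul_row_block !mulmx1 mulmx0 addr0 addrC. Qed.

Lemma shearD (K : fieldType) (A B : 'M[K]_n) : shear A *m shear B = shear (A + B).
Proof. by rewrite mulmx_block !mulmx0 !mul0mx !mulmx1 !mul1mx !addr0 add0r addrC. Qed.

Lemma shear0 (K : fieldType) : shear (0 : 'M[K]_n) = 1%:M.
Proof. by rewrite /shear -scalar_mx_block. Qed.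

Lemma shearKN (K : fieldType) (B : 'M[K]_n) : shear B *m shear (- B) = 1%:M.
Proof. by rewrite shearD subrr shear0. Qed.

Lemma shearNK (K : fieldType) (B : 'M[K]_n) : shear (- B) *m shear B = 1%:M.
Proof. by rewrite shearD addNr shear0. Qed.

Lemma shear_pairing (K : fieldType) (B : 'M[K]_n) : B^T = - B ->
  shear B *m pairing_mx K *m (shear B)^T = pairing_mx K.
Proof.
move=> hB; rewrite /shear /pairing_mx tr_block_mx !trmx1 trmx0 hB.
rewrite !mulmx_block !mulmx0 !mul0mx !mulmx1 !addr0 !add0r ?mul1mx.
by rewrite subrr mul0mx addr0.
Qed.

Lemma pairing_shear (K : fieldType) (B : 'M[K]_n) u v : B^T = - B ->
  pairing (u *m shear B) (v *m shear B) = pairing u v.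
Proof.
move=> hB; rewrite !pairing_mxE trmx_mul -!mulmxA.
by rewrite [shear B *m (_ *m _)]mulmxA [shear B *m _ *m _]mulmxA shear_pairing.
Qed.

(** The nilpotent part of e^F: [shear F] is [1 + nil_mx F], and [nil_mx F] has square 0. *)
Definition nil_mx (F : 'M[R]_n) : 'M[R]_(n + n) := block_mx 0 F 0 0.

Lemma cmx_nil_mx F : shear (iC *: cmx F) = 1%:M + iC *: cmx (nil_mx F).
Proof.
rewrite /shear /nil_mx cmx_block !cmx0 scale_block_mx !scaler0 (scalar_mx_block n n 1).
by rewrite add_block_mx !addr0 !add0r.
Qed.

Definition twist_a (J : 'M[R]_(n + n)) (F : 'M[R]_n) : 'M[R]_(n + n) :=
  1%:M + J *m nil_mx F.

(** The conjugate of J by [twist_a J F], where the latter is invertible. The use of [adjinv] makes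
    the entries visibly rational in those of J and F. *)
Definition twist (J : 'M[R]_(n + n)) (F : 'M[R]_n) : 'M[R]_(n + n) :=
  adjinv (twist_a J F) *m J *m twist_a J F.

(** The product with [nil_mx F] has zero left blocks, so [twist_a] is block upper triangular with
    diagonal 1 and 1 + pi F. For a generalized complex J the lower-left block pi is the underlying
    Poisson bivector. *)
Lemma det_twist_a J F : \det (twist_a J F) = \det (1%:M + dlsubmx J *m F).
Proof.
rewrite /twist_a /nil_mx -{1}[J]submxK mulmx_block !mulmx0 !addr0 (scalar_mx_block n n 1).
by rewrite add_block_mx !add0r addr0 det_ublock det1 mul1r.
Qed.

Lemma twist_sqr J F : twist_a J F \in unitmx -> J *m J = - 1%:M ->
  twist J F *m twist J F = - 1%:M.
Proof.
move=> u J2; rewrite /twist adjinvE // -!mulmxA [_ *m (invmx _ *m _)]mulmxA mulmxV // mul1mx.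
by rewrite [J *m (J *m _)]mulmxA J2 mulNmx mul1mx mulmxN mulVmx.
Qed.

(* On the +i-eigenspace of J, the shear by the complex form i F coincides with
   the real matrix 1 + J nil_mx F. *)
Lemma twist_eigen a J F (U : 'M[C]_(a, n + n)) : twist_a J F \in unitmx ->
  U *m cmx (twist J F) = iC *: U <->
  (U *m shear (- (iC *: cmx F))) *m cmx J = iC *: (U *m shear (- (iC *: cmx F))).
Proof.
move=> u.
have eig (V : 'M[C]_(a, n + n)) : V *m cmx J = iC *: V ->
    V *m cmx (twist_a J F) = V *m shear (iC *: cmx F).
  move=> hV; rewrite cmx_nil_mx /twist_a cmxD cmx1 cmxM !mulmxDr mulmx1; congr (_ + _).
  by rewrite mulmxA hV -scalemxAl -scalemxAr.
have cu : cmx (twist_a J F) *m cmx (invmx (twist_a J F)) = 1%:M.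
  by rewrite -cmxM mulmxV // cmx1.
have uc : cmx (invmx (twist_a J F)) *m cmx (twist_a J F) = 1%:M.
  by rewrite -cmxM mulVmx // cmx1.
rewrite /twist adjinvE // !cmxM; split => h.
  pose V := U *m cmx (invmx (twist_a J F)).
  have hV : V *m cmx J = iC *: V.
    rewrite /V -[LHS]mulmx1 -cu !mulmxA -/V.
    by move: h; rewrite !mulmxA => ->; rewrite -scalemxAl.
  have UV : U = V *m shear (iC *: cmx F) by rewrite -eig // /V -mulmxA uc mulmx1.
  have e : U *m shear (- (iC *: cmx F)) = V by rewrite {1}UV -mulmxA shearKN mulmx1.
  by rewrite e.
set V := U *m shear _ in h *.
have UV : U = V *m cmx (twist_a J F).
  by rewrite eig // /V -mulmxA shearNK mulmx1.
by rewrite UV !mulmxA -[V *m _ *m _]mulmxA cu mulmx1 h -scalemxAl.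
Qed.

Definition orthogonal_mx (J : 'M[R]_(n + n)) := J *m pairing_mx R *m J^T = pairing_mx R.

(** Isotropy applied to the rows of J + i gives (J + i) Q (J + i)^T = 0, with Q the Gram matrix; its
    real part is J Q J^T - Q. *)
Lemma orthogonal_isotropic J : J *m J = - 1%:M ->
  (forall u v : 'rV[C]_(n + n), u *m cmx J = iC *: u -> v *m cmx J = iC *: v ->
     pairing u v = 0) -> orthogonal_mx J.
Proof.
move=> J2 iso.
set E := cmx J + iC%:M.
have hE : E *m cmx J = iC *: E by exact: eigen_addi.
have row_eig i : row i E *m cmx J = iC *: row i E.
  by rewrite -row_mul hE linearZ.
have EQ : E *m pairing_mx C *m E^T = 0.
  apply/matrixP => i j; have := iso _ _ (row_eig i) (row_eig j).
  rewrite pairing_mxE => /eqP; rewrite mulf_eq0 invr_eq0 pnatr_eq0 /= => /eqP h.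
  rewrite [RHS]mxE -h -row_mul tr_row mxE [RHS]mxE.
  by apply: eq_bigr => k _; rewrite [in RHS]mxE [in X in _ = _ * X]mxE.
have key : E *m pairing_mx C *m E^T =
  cmx (J *m pairing_mx R *m J^T - pairing_mx R) +
  iC *: cmx (J *m pairing_mx R + pairing_mx R *m J^T).
  rewrite /E linearD /= tr_scalar_mx mulmxDl mulmxDr mulmxDl mul_mx_scalar.
  rewrite !mul_scalar_mx -scalemxAl !cmxD cmxN !cmxM cmx_tr cmx_pairing_mx.
  rewrite !scalerDr scalerA sqr_iC scaleN1r -!addrA; congr (_ + _).
  by rewrite addrC [RHS]addrA [X in _ = X + _]addrC.
move: EQ; rewrite key => /cmx_ReIm [/eqP + _].
by rewrite subr_eq0 => /eqP.
Qed.

End Pointwise.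

(** * Bundles under shears, and the Poisson structures underlying them *)

Section Bundles.
Variables (R : realType) (n : nat) (M : manifold R n).
Local Notation C := (R[i]).
Local Notation iC := ('i%C : C).
Implicit Types (L : bundle M) (F P I : M -> 'M[R]_n) (J : M -> 'M[R]_(n + n)).

Definition eigD J : bundle M := fun p => [set u | u *m cmx (J p) = iC *: u].

Lemma expBE (B : M -> 'M[C]_n) L p :
  expB B L p = [set u | L p (u *m shear (- B p))].
Proof.
apply/seteqP; split => u /=.
  by move=> [X [a [-> h]]]; rewrite -shearE -mulmxA shearKN mulmx1.
move=> h; exists (lsubmx (u *m shear (- B p))), (rsubmx (u *m shear (- B p))).
by rewrite -shearE hsubmxK -mulmxA shearNK mulmx1.
Qed.

(** Results on the first factor apply to the second with F replaced by -F. *)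
Lemma def2E F L : def2 F L = def1 (fun p => - F p) L.
Proof.
rewrite /def2 /def1 (_ : (fun p => - (iC *: cmx (F p))) = fun p => iC *: cmx (- F p)) //.
by apply/funext => p; rewrite cmxN scalerN.
Qed.

Lemma isotropic_shear (A : set 'rV[C]_(n + n)) (B : 'M[C]_n) : B^T = - B ->
  isotropic A -> isotropic [set u | A (u *m shear (- B))].
Proof.
move=> hB iA u v /= Au Av; rewrite -(@pairing_shear _ _ (- B)); first exact: iA.
by rewrite linearN /= hB.
Qed.

Lemma maximal_isotropic_shear (A : set 'rV[C]_(n + n)) (B : 'M[C]_n) : B^T = - B ->
  maximal_isotropic A -> maximal_isotropic [set u | A (u *m shear (- B))].
Proof.
move=> hB [iA mA]; split; first exact: isotropic_shear.
move=> A' iA' AA' u A'u /=.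
have hB' : (- B)^T = - (- B) by rewrite linearN /= hB.
apply: (mA [set v | A' (v *m shear B)]) => [||/=].
- by have := isotropic_shear hB' iA'; rewrite opprK.
- by move=> v Av /=; apply: AA' => /=; rewrite -mulmxA shearKN mulmx1.
- by rewrite -mulmxA shearNK mulmx1.
Qed.

Lemma two_iC_neq0 : (2 * iC : C) != 0.
Proof. by rewrite mulf_neq0 ?pnatr_eq0 // iC_neq0. Qed.

Lemma sub_bundleE (c : C) L L' p : c != 0 ->
  scaleD c (subD L L') p = [set u | exists X a b,
    [/\ u = row_mx X (c *: (a - b)), L p (row_mx X a) & L' p (row_mx X b)]].
Proof.
move=> c0; apply/seteqP; split => u /=.
  move=> [X [d [-> [Y [a [b [e1 La [Y' [b' [e2 Lb]]]]]]]]]].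
  have [? ?] := eq_row_mx e1; have [? ?] := eq_row_mx e2; subst.
  by exists Y', a, b'; rewrite scaleN1r.
move=> [X [a [b [-> La Lb]]]]; exists X, (a - b); split=> //.
by exists X, a, (- b); split=> //; exists X, b; rewrite scaleN1r.
Qed.

Lemma conj_expB (B : M -> 'M[C]_n) L :
  conjD (expB B L) = expB (fun p => conjm (B p)) (conjD L).
Proof.
apply/funext => p; apply/seteqP; split => u /=.
  move=> [_ [X [a [-> h]]] <-]; exists (conjm X), (conjm a); split.
    by rewrite map_row_mx -conjmM -conjmD.
  by exists (row_mx X a) => //; rewrite map_row_mx.
move=> [X [a [-> [v Lv e]]]].
exists (row_mx (lsubmx v) (rsubmx v + lsubmx v *m B p)).
  by exists (lsubmx v), (rsubmx v); rewrite hsubmxK.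
rewrite map_row_mx -/(conjm _) -/(conjm (_ + _)) conjmD conjmM.
move: e; rewrite -{1}[v]hsubmxK map_row_mx => /eq_row_mx [<- <-] //.
Qed.

Lemma conj_eigD J L p : L p = eigD J p ->
  conjD L p = [set u | u *m cmx (J p) = - iC *: u].
Proof.
rewrite /conjD => ->; apply/seteqP; split => u /=.
  by move=> [v hv <-]; have := eigen_conj hv; rewrite conj_iC.
move=> h; exists (conjm u); last exact: conjmK.
by have := eigen_conj h; rewrite -{1}conj_iC conjcK.
Qed.

(** The covector parts change by iXF and -iXF; their difference 2iXF, divided by 2i, is the effect
    of e^F. *)
Lemma sigma_plus_def F L1 L2 :
  sigma_plus (def1 F L1) (def2 F L2) = expF F (sigma_plus L1 L2).
Proof.
have c0 : ((2 * iC)^-1 : C) != 0 by rewrite invr_eq0 two_iC_neq0.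
have e (X a b : 'rV[C]_n) (G : 'M[C]_n) :
   (2 * iC)^-1 *: (a + X *m (iC *: G) - (b + X *m - (iC *: G))) =
   (2 * iC)^-1 *: (a - b) + X *m G.
  rewrite mulmxN opprD opprK addrACA -scalemxAr -scalerDl scalerDr scalerA.
  rewrite -mulr2n -[iC *+ 2]mulr_natl mulVf ?two_iC_neq0 // scale1r.
  by [].
apply/funext => p; rewrite /sigma_plus sub_bundleE //.
apply/seteqP; split => u /=.
  move=> [X [_ [_ [-> [Y [a [/eq_row_mx [-> ->] La]]]]]]] [Z [b [/eq_row_mx [eY ->] Lb]]].
  exists Y, ((2 * iC)^-1 *: (a - b)); split; first by rewrite -eY e.
  by rewrite sub_bundleE //; exists Y, a, b; split => //; rewrite eY.
move=> [X [d [-> ]]]; rewrite sub_bundleE // => -[Y [a [b [ed La Lb]]]].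
have [-> ->] := eq_row_mx ed.
exists Y, (a + Y *m (iC *: cmx (F p))), (b + Y *m - (iC *: cmx (F p))); split.
- by rewrite e.
- by exists Y, a.
- by exists Y, b.
Qed.

(** Conjugation turns e^{-iF} into e^{iF} because F is real, so both terms are sheared alike and the
    difference is unchanged. *)
Lemma sigma_minus_def F L1 L2 :
  sigma_minus (def1 F L1) (def2 F L2) = sigma_minus L1 L2.
Proof.
have c0 : ((2 * iC)^-1 : C) != 0 by rewrite invr_eq0 two_iC_neq0.
rewrite /sigma_minus def2E /def1 conj_expB.
have -> : (fun p => conjm (iC *: cmx (- F p))) = fun p => iC *: cmx (F p).
  by apply/funext => p; rewrite conjmZ conjm_cmx conj_iC cmxN scalerN scaleNr opprK.
apply/funext => p; rewrite !sub_bundleE //.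
apply/seteqP; split => u /=.
  move=> [X [_ [_ [-> [Y [a [/eq_row_mx [-> ->] La]]]]]]] [Z [b [/eq_row_mx [eY ->] Lb]]].
  exists Y, a, b; split; [|exact: La|by rewrite eY].
  by rewrite eY opprD addrACA subrr addr0.
move=> [X [a [b [-> La Lb]]]].
exists X, (a + X *m (iC *: cmx (F p))), (b + X *m (iC *: cmx (F p))); split.
- by rewrite opprD addrACA subrr addr0.
- by exists X, a.
- by exists X, b.
Qed.

(** A vector of T01 lies in [L_hol] with zero covector. That covector is a nonzero multiple of a
    difference of covectors from L and L', so these two agree. *)
Lemma T01_lift L L' I (s : M -> 'M[C]_n) p : L_hol I s p = scaleD (2 * iC)^-1 (subD L L') p ->
  forall X, X *m cmx (I p) = - iC *: X ->
  exists xi, L p (row_mx X xi) /\ L' p (row_mx X xi).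
Proof.
have c0 : ((2 * iC)^-1 : C) != 0 by rewrite invr_eq0 two_iC_neq0.
move=> e X hX.
have : L_hol I s p (row_mx X 0).
  by exists X, 0; split; rewrite ?mul0mx ?addr0 // /Tstar10 /= mul0mx scaler0.
rewrite e sub_bundleE // => -[Y [a [b [/eq_row_mx [-> h] La Lb]]]].
move/esym/eqP: h; rewrite scaler_eq0 (negbTE c0) subr_eq0 /= => /eqP ab.
by exists a; rewrite {2}ab.
Qed.

(** For a real covector xi and w = xi J, the rows w + i xi and w - i xi are eigenvectors of J for i
    and -i. They share the vector part of w and their covectors differ by 2i xi, so the graph sends
    xi to its image under the lower-left block of J. *)
Lemma graph_real_part P J L p : J p *m J p = - 1%:M -> L p = eigD J p ->
  graphD P p = real_part L p -> P p = dlsubmx (J p).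
Proof.
have c0 : ((2 * iC)^-1 : C) != 0 by rewrite invr_eq0 two_iC_neq0.
move=> J2 eL; rewrite /real_part sub_bundleE // (conj_eigD eL) eL => e.
apply: cmx_inj; apply/row_matrixP => k.
pose xi : 'rV[R]_n := delta_mx 0 k.
pose w := row_mx 0 xi *m J p.
have ew : w *m J p = - row_mx 0 xi by rewrite -mulmxA J2 mulmxN mulmx1.
have hw : row_mx 0 xi *m J p = w by [].
have : graphD P p (row_mx (cmx (lsubmx w)) (cmx xi)).
  rewrite e /=.
  exists (cmx (lsubmx w)), (cmx (rsubmx w) + iC *: cmx xi), (cmx (rsubmx w) - iC *: cmx xi).
  have wE : cmx w = row_mx (cmx (lsubmx w)) (cmx (rsubmx w)).
    by rewrite -map_row_mx hsubmxK.
  have xiE : cmx (row_mx 0 xi) = row_mx (0 : 'rV_n) (cmx xi).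
    by rewrite /cmx map_row_mx map_mx0.
  split.
  - rewrite opprD opprK addrACA subrr add0r -scalerDl scalerA.
    by rewrite -(mulr2n iC) -[iC *+ 2]mulr_natl mulVf ?two_iC_neq0 // scale1r.
  - have -> : row_mx (cmx (lsubmx w)) (cmx (rsubmx w) + iC *: cmx xi) =
        cmx w + iC *: cmx (row_mx 0 xi).
      by rewrite wE xiE scale_row_mx scaler0 add_row_mx addr0.
    rewrite /eigD /= mulmxDl -cmxM ew -scalemxAl -cmxM hw scalerDr scalerA sqr_iC scaleN1r.
    by rewrite cmxN addrC.
  - have -> : row_mx (cmx (lsubmx w)) (cmx (rsubmx w) - iC *: cmx xi) =
        cmx w - iC *: cmx (row_mx 0 xi).
      by rewrite wE xiE scale_row_mx scaler0 opp_row_mx add_row_mx oppr0 addr0.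
    rewrite /= mulmxBl -cmxM ew -scalemxAl -cmxM hw scalerBr scalerA mulNr sqr_iC opprK scale1r.
    by rewrite cmxN scaleNr addrC.
move=> [eta _ /eq_row_mx [e1 e2]]; move: e1; rewrite e2 => e1.
have ewk : lsubmx w = xi *m dlsubmx (J p).
  by rewrite /w -{1}[J p]submxK mul_row_block mul0mx add0r row_mxKl.
have dE : cmx xi = delta_mx 0 k by rewrite /cmx map_delta_mx.
by rewrite !rowE -dE e1 ewk cmxM.
Qed.

(* T01 of the two complex structures, lifted to L1' n L2' and to
   L1' n conj L2', fills out L1'. *)
Lemma commute_eig J1 J2 L1 L2 (Ip Im : M -> 'M[R]_n) (sp sm : M -> 'M[C]_n) p :
  J1 p *m J1 p = - 1%:M -> L1 p = eigD J1 p -> L2 p = eigD J2 p ->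
  Ip p *m Ip p = - 1%:M -> Im p *m Im p = - 1%:M ->
  L_hol Ip sp p = sigma_plus L1 L2 p -> L_hol Im sm p = sigma_minus L1 L2 p ->
  J1 p *m J2 p = J2 p *m J1 p.
Proof.
move=> J11 e1 e2 Ip2 Im2 hp hm.
(* The common eigenvectors of J1 for i and of J2 for c: W(i) is the intersection of L1 with L2, and
   W(-i) that of L1 with the conjugate of L2. *)
pose W (c : C) := kermx (row_mx (cmx (J1 p) - iC%:M) (cmx (J2 p) - c%:M)).
have WP c k (u : 'M[C]_(k, n + n)) : (u <= W c)%MS <->
    u *m cmx (J1 p) = iC *: u /\ u *m cmx (J2 p) = c *: u.
  rewrite sub_kermx mul_mx_row -(row_mx0 C k) ?mulmxBr ?mul_mx_scalar.
  split=> [/eqP /eq_row_mx [/eqP + /eqP]|[-> ->]]; last by rewrite !subrr.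
  by rewrite !subr_eq0 => /eqP -> /eqP ->.
have [W1 W2] := (WP iC _ _).1 (submx_refl (W iC)).
have [W3 W4] := (WP (- iC) _ _).1 (submx_refl (W (- iC))).
have r1 : (n <= 2 * \rank (W iC))%N.
  apply: (rank_lift Ip2) => X /(T01_lift hp) [xi [h1 h2]]; exists xi.
  by apply/WP; move: h1 h2; rewrite e1 e2.
have r2 : (n <= 2 * \rank (W (- iC)))%N.
  apply: (rank_lift Im2) => X /(T01_lift hm) [xi [h1 h2]]; exists xi.
  by apply/WP; move: h1 h2; rewrite (conj_eigD e2) e1.
apply: (commute_rank J11 W1 W2 W3 W4).
have arith a b : (n <= 2 * a)%N -> (n <= 2 * b)%N -> (n + n <= 2 * (a + b))%N by lia.
exact: arith r1 r2.
Qed.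

End Bundles.

(** * Positive definite quadratic forms along a path *)

Section PositiveDefinite.
Variables (R : realType) (m : nat).
Implicit Types (S : 'M[R]_m) (u v : 'rV[R]_m).

Definition qf S u : R := (u *m S *m u^T) 0 0.

Definition posdef S := forall u, u != 0 -> 0 < qf S u.

Lemma qfD S u v c : S^T = S ->
  qf S (u + c *: v) = qf S u + 2 * c * (u *m S *m v^T) 0 0 + c ^+ 2 * qf S v.
Proof.
move=> hS.
have vu : (v *m S *m u^T) 0 0 = (u *m S *m v^T) 0 0.
  have e : (v *m S *m u^T)^T = u *m S *m v^T by rewrite !trmx_mul trmxK hS mulmxA.
  by rewrite -e [RHS]mxE.
rewrite /qf linearD linearZ /= mulmxDl mulmxDr -!scalemxAl mulmxDl -!scalemxAl -!scalemxAr.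
rewrite (mulmxDl (u *m S)) -!scalemxAl.
move: (u *m S *m u^T) (v *m S *m u^T) (u *m S *m v^T) (v *m S *m v^T) vu => p q r s e.
by rewrite !mxE e; ring.
Qed.

(** A null vector of a semidefinite form lies in its radical, which is 0 for an invertible
    matrix. *)
Lemma posdef_semi S : S^T = S -> S \in unitmx -> (forall u, 0 <= qf S u) -> posdef S.
Proof.
move=> hS uS nS u u0; rewrite lt_neqAle nS andbT eq_sym; apply/negP => /eqP q0.
suff uS0 : u *m S = 0.
  by move/negP: u0; apply; rewrite -[u]mulmx1 -(mulmxV uS) mulmxA uS0 mul0mx.
apply/rowP => j; rewrite [RHS]mxE.
pose v : 'rV[R]_m := delta_mx 0 j.
set b := (u *m S) 0 j.
have bE : (u *m S *m v^T) 0 0 = b by rewrite /v trmx_delta -colE mxE.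
apply/eqP; apply/negPn/negP => b0.
(* The minimiser over c would be -b / qf S v; adding 1 keeps the denominator positive even if
   [qf S v] is 0, and the value is still negative. *)
pose c := - b / (qf S v + 1).
have vp : 0 < qf S v + 1 by rewrite ltr_wpDl.
have := nS (u + c *: v); rewrite qfD // q0 bE add0r leNgt => /negP; apply.
have -> : 2 * c * b + c ^+ 2 * qf S v = - (b ^+ 2 * (qf S v + 2)) / (qf S v + 1) ^+ 2.
  by rewrite /c; field; rewrite gt_eqF.
rewrite mulNr oppr_lt0 divr_gt0 ?exprn_gt0 // mulr_gt0 //; last by have := nS v; lra.
by rewrite lt_neqAle sqr_ge0 andbT eq_sym sqrf_eq0.
Qed.

Lemma continuous_qf (T : topologicalType) (S : T -> 'M[R]_m) (u : T -> 'rV[R]_m) t :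
  (forall i j, {for t, continuous (fun s => S s i j)}) ->
  (forall i j, {for t, continuous (fun s => u s i j)}) ->
  {for t, continuous (fun s => qf (S s) (u s))}.
Proof.
have hP := @continuous_subring R T t.
move=> hS hu.
exact: (mx_funM hP (mx_funM hP hu hS) (mx_fun_tr hu)).
Qed.

(** Compactness of the unit sphere makes the neighbourhood uniform in the vector, and homogeneity
    extends positivity to all nonzero vectors. *)
Lemma near_posdef (T : topologicalType) (S : T -> 'M[R]_m) t :
  (forall i j, {for t, continuous (fun s => S s i j)}) ->
  posdef (S t) -> \forall s \near t, posdef (S s).
Proof.
move=> cS pS.
pose K : set 'rV[R]_m := [set u | `|u| = 1].
have cK : compact K.
  apply: bounded_closed_compact.
    by exists 1; split=> // x x1 u /= ->; exact: ltW.
  apply: (@closed_comp _ _ (fun u : 'rV[R]_m => `|u|) [set x | x = 1]).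
    by move=> u _; exact: norm_continuous.
  exact: closed_eq.
have : \forall s \near t, K `<=` (fun u => 0 < qf (S s) u).
  move/compact_near_coveringP: cK; apply => u Ku.
  have : {for (u, t), continuous (fun z : 'rV[R]_m * T => qf (S z.2) z.1)}.
    apply: continuous_qf => i j.
      by apply: (@continuous_comp _ _ _ snd (fun s => S s i j)); [exact: cvg_snd|exact: cS].
    by apply: (@continuous_comp _ _ _ fst (fun v : 'rV[R]_m => v i j));
      [exact: cvg_fst|exact: coord_continuous].
  move=> /(_ [set z | 0 < z]); apply.
  apply: open_nbhs_nbhs; split; first exact: open_gt.
  by apply: pS; rewrite -normr_eq0 Ku oner_eq0.
apply: filterS => s hs u u0.
have nu : 0 < `|u| by rewrite normr_gt0.
have := hs (`|u|^-1 *: u); rewrite /K /= normrZ normfV normr_id mulVf ?normr_eq0 // => /(_ erefl).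
rewrite /qf linearZ /= -!scalemxAl -scalemxAr !mxE mulrA -expr2 pmulr_rgt0 //.
by rewrite exprn_gt0 // invr_gt0.
Qed.

(* Positivity is an open condition, and among nondegenerate forms so is its
   failure, which is witnessed by a vector of negative square. *)
Lemma posdef_path (S : R -> 'M[R]_m) (a b s0 : R) :
  (forall s, a < s < b -> (S s)^T = S s /\ S s \in unitmx) ->
  (forall s, a < s < b -> forall i j, {for s, continuous (fun r => S r i j)}) ->
  a < s0 < b -> posdef (S s0) -> forall s, a < s < b -> posdef (S s).
Proof.
move=> hS cS s0ab ps0.
pose B : set R := `]a, b[%classic.
have BE s : B s = (a < s < b) by rewrite /B /= in_itv.
pose A := B `&` [set s | posdef (S s)].
have cB : connected B by apply/connected_intervalP; exact: interval_is_interval.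
suff AB : A = B by move=> s; rewrite -BE -AB => -[].
apply: cB.
- by exists s0; split=> //; rewrite BE.
- exists (interior [set s | posdef (S s)]); first exact: open_interior.
  apply/seteqP; split => s [Bs hs]; split=> //; last exact: interior_subset hs.
  apply: (@near_posdef R S s) => //.
  by apply: cS; rewrite -BE.
(* Relative closedness in [B]: what remains is that failure of positivity is an open condition along
   [B]. *)
exists (~` interior [set s | ~ posdef (S s)]); first exact/open_closedC/open_interior.
apply/seteqP; split => s [Bs hs]; split=> //.
  by move=> /interior_subset /=; apply.
apply: contrapT => np; apply: hs.
have [sS uS] : (S s)^T = S s /\ S s \in unitmx by apply: hS; rewrite -BE.
(* By [posdef_semi], an invertible form that is not positive definite is not even semidefinite. *)
have [u hu] : exists u, qf (S s) u < 0.
  apply: contrapT => /forallNP nu; apply: np; apply: posdef_semi => // u.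
  by rewrite leNgt; apply/negP; exact: nu.
have : {for s, continuous (fun r => qf (S r) u)}.
  apply: continuous_qf => i j; last exact: cst_continuous.
  by apply: cS; rewrite -BE.
move=> /(_ [set z | z < 0]) /= h.
have {h} : \forall r \near s, qf (S r) u < 0.
  by apply: h; apply: open_nbhs_nbhs; split => //; exact: open_lt.
apply: filterS => r hr pr.
have u0 : u != 0 by apply: contraTneq hr => ->; rewrite /qf !mul0mx mxE ltxx.
by have := pr u u0; rewrite ltNge (ltW hr).
Qed.

End PositiveDefinite.

(** * Behaviour of shears and conjugates under a change of frame *)

(** The block-diagonal factor is a change of frame on vectors and covectors; the form on the right
    is B in the new frame. *)
Lemma shear_block (K : fieldType) n (A A' B : 'M[K]_n) : A *m A' = 1%:M ->
  shear B *m block_mx A 0 0 A'^T = block_mx A 0 0 A'^T *m shear (A' *m B *m A'^T).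
Proof.
move=> AA; rewrite /shear !mulmx_block !mulmx0 !mul0mx !mulmx1 !mul1mx !addr0 !add0r.
by rewrite !mulmxA AA mul1mx.
Qed.

Section Conjugation.
Variables (K : fieldType) (m : nat) (G G' : 'M[K]_m).
Hypotheses (GG : G *m G' = 1%:M) (GG' : G' *m G = 1%:M).

Lemma conj_mulmx A B : (G' *m A *m G) *m (G' *m B *m G) = G' *m (A *m B) *m G.
Proof. by rewrite !mulmxA -[G' *m A *m G *m G']mulmxA GG mulmx1. Qed.

Lemma conj_addmx1 A : 1%:M + G' *m A *m G = G' *m (1%:M + A) *m G.
Proof. by rewrite mulmxDr mulmxDl mulmx1 GG'. Qed.

Lemma conj_det A : \det (G' *m A *m G) = \det A.
Proof. by rewrite !det_mulmx mulrAC -det_mulmx GG' det1 mul1r. Qed.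

Lemma conj_adjinv A : A \in unitmx -> adjinv (G' *m A *m G) = G' *m adjinv A *m G.
Proof.
move=> u; have u' : G' *m A *m G \in unitmx by rewrite unitmxE conj_det -unitmxE.
rewrite !adjinvE //; apply: (can_inj (mulKmx u')).
by rewrite mulmxV // conj_mulmx mulmxV // mulmx1 GG'.
Qed.

End Conjugation.

(** * Charts: frame changes and smoothness of local expressions *)

Section Charts.
Variables (R : realType) (n : nat) (M : manifold R n).
Local Notation C := (R[i]).
Local Notation iC := ('i%C : C).
Local Notation coord := (@Defs.coord R n M).
Implicit Types (p q r : M) (P : M -> Prop).

Lemma near_chart p r : dom p r ->
  \forall x \near coord p r, dom p (param p x) /\ coord p (param p x) = x.
Proof.
move=> pr; have : nbhs (coord p r) (coord p @` dom p).
  by apply: open_nbhs_nbhs; split; [exact: coord_open|exists r].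
by apply: filterS => x [q pq <-]; rewrite coordK.
Qed.

Lemma near_param p r P : dom p r -> (\forall q \near r, P q) ->
  \forall x \near coord p r, P (param p x).
Proof.
move=> pr; rewrite -{1}(coordK pr) => hP.
exact: (param_continuous pr hP).
Qed.

Lemma near_dom p q : dom p q -> \forall r \near q, dom p r.
Proof. by move=> pq; apply: open_nbhs_nbhs; split=> //; exact: dom_open. Qed.

Lemma differentiable_rV (V : normedModType R) m (f : V -> 'rV[R]_m) x :
  (forall k, differentiable (fun y => f y 0 k) x) -> differentiable f x.
Proof.
move=> hf; have -> : f = \sum_(k < m) (fun y => f y 0 k *: delta_mx 0 k).
  by apply/funext => y; rewrite fct_sumE {1}[f y]row_sum_delta.
by apply: differentiable_sum => k; exact: differentiableZl.
Qed.

Lemma transition_differentiable p q r : dom p r -> dom q r ->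
  differentiable (coord q \o param p) (coord p r).
Proof.
move=> pr qr; apply: differentiable_rV => k.
exact: smooth_at_diff (transition_smooth pr qr k).
Qed.

Lemma diff_near_id (f : 'rV[R]_n -> 'rV[R]_n) x : (\forall y \near x, f y = y) ->
  'd f x = id :> ('rV[R]_n -> 'rV[R]_n).
Proof.
move=> fx; have h : \forall y \near x, id y = f y by apply: filterS fx.
by have [] := near_eq_diff h (@ex_diff _ _ _ _ _ _ _ (is_diff_id x)) => _ ->; exact: diff_val.
Qed.

Lemma trans_id p : trans p p p = 1%:M.
Proof.
apply/row_matrixP => i; rewrite !rowE mulmx1 /trans /jacobian mul_rV_lin1.
rewrite diff_near_id //.
by apply: filterS (near_chart (dom_refl p)) => x [].
Qed.

(** Chain rule for the two transition maps, whose composite is the identity near [coord p r]. *)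
Lemma transK p q r : dom p r -> dom q r -> trans p q r *m trans q p r = 1%:M.
Proof.
move=> pr qr; apply/row_matrixP => i.
rewrite !rowE mulmx1 mulmxA /trans /jacobian !mul_rV_lin1.
have df := transition_differentiable pr qr.
have dg := transition_differentiable qr pr.
set f := coord q \o param p in df *; set g := coord p \o param q in dg *.
have fx : f (coord p r) = coord q r by rewrite /f /= coordK.
rewrite -fx in dg *.
have := diff_comp df dg => e.
apply: etrans (esym (congr1 (fun k : 'rV[R]_n -> 'rV[R]_n => k (delta_mx 0 i)) e)) _.
have h := near_param pr (near_dom qr).
have gf : \forall x \near coord p r, (g \o f) x = x.
  apply: filterS2 (near_chart pr) h => x [h1 h2] h3.
  by rewrite /g /f /= coordK.
exact: (congr1 (fun k : 'rV[R]_n -> 'rV[R]_n => k (delta_mx 0 i)) (diff_near_id gf)).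
Qed.

Lemma gtransK p q r : dom p r -> dom q r -> gtrans p q r *m gtrans q p r = 1%:M.
Proof.
move=> pr qr; rewrite /gtrans mulmx_block !mulmx0 !mul0mx !addr0 add0r.
by rewrite -trmx_mul !transK // trmx1 -scalar_mx_block.
Qed.

Lemma shear_gtrans p q (B : 'M[C]_n) : dom p q ->
  shear B *m cmx (gtrans q p q) =
  cmx (gtrans q p q) *m shear (cmx (trans p q q) *m B *m (cmx (trans p q q))^T).
Proof.
move=> pq; rewrite /gtrans cmx_block !cmx0 cmx_tr; apply: shear_block.
by rewrite -cmxM transK // ?cmx1 //; exact: dom_refl.
Qed.

Lemma nil_mx_gtrans p q (F : 'M[R]_n) :
  nil_mx (trans p q q *m F *m (trans p q q)^T) = gtrans p q q *m nil_mx F *m gtrans q p q.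
Proof.
rewrite /nil_mx /gtrans !mulmx_block !mulmx0 !mul0mx !addr0 ?add0r.
by rewrite ?mulmx0 ?mul0mx ?addr0 ?add0r.
Qed.

Lemma twist_a_gtrans p q J (F : 'M[R]_n) : dom p q ->
  twist_a (gtrans p q q *m J *m gtrans q p q) (trans p q q *m F *m (trans p q q)^T)
   = gtrans p q q *m twist_a J F *m gtrans q p q.
Proof.
move=> pq; have qq := dom_refl q.
by rewrite /twist_a nil_mx_gtrans conj_mulmx ?conj_addmx1 // gtransK.
Qed.

Lemma det_twist_a_gtrans p q J (F : 'M[R]_n) : dom p q ->
  \det (twist_a (gtrans p q q *m J *m gtrans q p q) (trans p q q *m F *m (trans p q q)^T))
   = \det (twist_a J F).
Proof.
move=> pq; have qq := dom_refl q.
by rewrite twist_a_gtrans // conj_det // gtransK.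
Qed.

(** Lets the twist be computed from the local expressions of J and F in a single chart, where its
    smoothness can be checked. *)
Lemma twist_gtrans p q J (F : 'M[R]_n) : dom p q -> twist_a J F \in unitmx ->
  gtrans p q q *m twist J F *m gtrans q p q =
  twist (gtrans p q q *m J *m gtrans q p q) (trans p q q *m F *m (trans p q q)^T).
Proof.
move=> pq u; have qq := dom_refl q.
have GG : gtrans q p q *m gtrans p q q = 1%:M by rewrite gtransK.
have GG' : gtrans p q q *m gtrans q p q = 1%:M by rewrite gtransK.
rewrite /twist twist_a_gtrans // (conj_adjinv GG GG' u).
by rewrite (conj_mulmx GG) (conj_mulmx GG).
Qed.

(** In the chart at p the entries are rational functions of smooth entries. Invertibility is assumed
    near p because naturality of the twist is applied at every nearby point. *)
Lemma smooth_twist p (J : M -> 'M[R]_(n + n)) (F : M -> 'M[R]_n) :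
  smooth_mx_at (loc_gend p J) (coord p p) ->
  (forall i j, smooth_at (fun x => loc_form2 p F x i j) (coord p p)) ->
  (\forall q \near p, twist_a (J q) (F q) \in unitmx) ->
  smooth_mx_at (loc_gend p (fun q => twist (J q) (F q))) (coord p p).
Proof.
move=> sJ sF uJ; have pp := dom_refl p.
pose Jh x := let q := param p x in gtrans p q q *m J q *m gtrans q p q.
have sJh : forall i j, smooth_at (fun x => Jh x i j) (coord p p).
  exact: (smooth_mx_at_cmx Jh (coord p p)).1 sJ.
have hP := smooth_at_subring (coord p p).
apply: (smooth_mx_at_near (f := fun x => cmx (twist (Jh x) (loc_form2 p F x)))).
  apply: filterS2 (near_chart pp) (near_param pp uJ) => x [h1 h2] h3.
  by rewrite /loc_gend twist_gtrans.
apply/smooth_mx_at_cmx.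
have sa : mx_fun (fun f => smooth_at f (coord p p))
    (fun x => twist_a (Jh x) (loc_form2 p F x)).
  apply: (mx_funD hP); first exact: mx_fun_cst.
  apply: (mx_funM hP) => //.
  by apply: mx_fun_block => //; exact: (mx_fun_cst hP 0).
apply: (mx_funM hP) => //; apply: (mx_funM hP) => //.
apply: (mx_fun_inv (x0 := coord p p) hP) => //.
  by move=> f; exact: smooth_atV.
rewrite unitmxE /Jh /loc_form2 coordK // det_twist_a_gtrans // -unitmxE.
exact: nbhs_singleton uJ.
Qed.

Lemma loc_sec_shear p (u : M -> 'rV[C]_(n + n)) F x : dom p (param p x) ->
  loc_sec p (fun q => u q *m shear (iC *: cmx (F q))) x =
  loc_sec p u x *m shear (iC *: cmx (loc_form2 p F x)).
Proof.
move=> h; rewrite /loc_sec -mulmxA shear_gtrans // mulmxA; congr (_ *m shear _).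
by rewrite -scalemxAr -scalemxAl /loc_form2 !cmxM cmx_tr.
Qed.

Lemma smooth_sec_shear p (u : M -> 'rV[C]_(n + n)) (F : M -> 'M[R]_n) :
  (forall i j, smooth_at (fun x => loc_form2 p F x i j) (coord p p)) ->
  smooth_sec_at u p -> smooth_sec_at (fun q => u q *m shear (iC *: cmx (F q))) p.
Proof.
move=> sF su; have hP := smoothC_at_subring (coord p p).
apply: (smooth_mx_at_near (f := fun x => loc_sec p u x *m shear (iC *: cmx (loc_form2 p F x)))).
  apply: filterS (near_chart (dom_refl p)) => x [h _].
  by rewrite loc_sec_shear.
have sFh : mx_fun (fun f => smoothC_at f (coord p p)) (fun x => cmx (loc_form2 p F x)).
  exact/smooth_mx_at_cmx.
apply: (mx_funM hP) => //; apply: mx_fun_block.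
- exact: (mx_fun_cst hP).
- by apply: (mx_funZ hP (f := fun=> iC)) => //; have [Pc _ _] := hP; exact: Pc.
- exact: (mx_fun_cst hP).
- exact: (mx_fun_cst hP).
Qed.

Lemma subbundle_def1 p (L : bundle M) (F : M -> 'M[R]_n) :
  (forall i j, smooth_at (fun x => loc_form2 p F x i j) (coord p p)) ->
  subbundle_at L p -> subbundle_at (def1 F L) p.
Proof.
move=> sF [k [e [se he]]]; exists k, (fun q => e q *m shear (iC *: cmx (F q))); split.
  move=> i; rewrite (_ : (fun _ => _) = fun q => row i (e q) *m shear (iC *: cmx (F q))).
    exact: smooth_sec_shear.
  by apply/funext => q; rewrite row_mul.
apply: filterS he => q [fe Le]; split.
  have fs : row_free (shear (iC *: cmx (F q))).
    by apply/row_freeP; exists (shear (- (iC *: cmx (F q)))); exact: shearKN.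
  by move: fe; rewrite /row_free (mxrankMfree (e q) fs).
rewrite /def1 expBE Le; apply/seteqP; split => u /=.
  by move=> /(submxMr (shear (iC *: cmx (F q)))); rewrite -mulmxA shearNK mulmx1.
by move=> /(submxMr (shear (- (iC *: cmx (F q))))); rewrite -mulmxA shearKN mulmx1.
Qed.

End Charts.

(** * Invariance of the Courant bracket under closed shears *)

Section CourantShear.

(** The covector part of the bracket of sheared sections after the Leibniz rule, as an identity
    between free symbols: [dX i k] stands for the i-th derivative of the k-th component, [dB i k l]
    for that of the entry (k, l) of B, and the last hypothesis for dB = 0. *)
Lemma courant_sum (K : comRingType) n (X Y eta : 'I_n -> K)
    (dX dY deta dxi B : 'I_n -> 'I_n -> K) (dB : 'I_n -> 'I_n -> 'I_n -> K) j :
  (forall i k, B i k = - B k i) -> (forall i k l, dB i k l = - dB i l k) ->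
  (forall i k l, dB i k l + dB k l i + dB l i k = 0) ->
  \sum_i (X i * (deta i j + \sum_k (Y k * dB i k j + dY i k * B k j)) +
          (eta i + \sum_k Y k * B k i) * dX j i) -
  \sum_i (Y i * ((dxi i j + \sum_k (X k * dB i k j + dX i k * B k j)) -
                 (dxi j i + \sum_k (X k * dB j k i + dX j k * B k i)))) =
  \sum_i (X i * deta i j + eta i * dX j i) - \sum_i (Y i * (dxi i j - dxi j i)) +
  \sum_k (\sum_i (X i * dY i k - Y i * dX i k)) * B k j.
Proof.
move=> sB sdB cB.
pose a i k := X i * (Y k * dB i k j + dY i k * B k j) + Y k * B k i * dX j i.
pose b i k := Y i * ((X k * dB i k j + dX i k * B k j) - (X k * dB j k i + dX j k * B k i)).
pose c i k := (X i * dY i k - Y i * dX i k) * B k j.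
have -> : \sum_i (X i * (deta i j + \sum_k (Y k * dB i k j + dY i k * B k j)) +
          (eta i + \sum_k Y k * B k i) * dX j i) =
    \sum_i (X i * deta i j + eta i * dX j i) + \sum_i \sum_k a i k.
  rewrite -big_split; apply: eq_bigr => i _ /=.
  have -> : \sum_k a i k = X i * (\sum_k (Y k * dB i k j + dY i k * B k j)) +
      (\sum_k Y k * B k i) * dX j i by rewrite mulr_sumr mulr_suml -big_split.
  by ring.
have -> : \sum_i (Y i * ((dxi i j + \sum_k (X k * dB i k j + dX i k * B k j)) -
                 (dxi j i + \sum_k (X k * dB j k i + dX j k * B k i)))) =
    \sum_i (Y i * (dxi i j - dxi j i)) + \sum_i \sum_k b i k.
  rewrite -big_split; apply: eq_bigr => i _ /=.
  have -> : \sum_k b i k = Y i * ((\sum_k (X k * dB i k j + dX i k * B k j)) -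
      \sum_k (X k * dB j k i + dX j k * B k i)) by rewrite -sumrB mulr_sumr.
  by ring.
have -> : \sum_k (\sum_i (X i * dY i k - Y i * dX i k)) * B k j = \sum_i \sum_k c i k.
  by rewrite exchange_big; apply: eq_bigr => k _; rewrite mulr_suml.
(* After cancellation the surplus is g i k - g k i, which sums to 0. *)
pose g i k := X i * Y k * dB i k j + Y k * B k i * dX j i.
have e : \sum_i \sum_k a i k - \sum_i \sum_k b i k - \sum_i \sum_k c i k =
    \sum_i \sum_k g i k - \sum_i \sum_k g k i.
  rewrite -!sumrB; apply: eq_bigr => i _; rewrite -!sumrB; apply: eq_bigr => k _.
  (* This is where closedness of B enters. *)
  have h : dB i k j = dB k i j + dB j k i.
    have := cB k i j; rewrite (sdB i j k) => h.
    by apply/eqP; rewrite eq_sym -subr_eq0 -h; apply/eqP; ring.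
  by rewrite /a /b /c /g (sB i k) h; ring.
have gg : \sum_i \sum_k g i k = \sum_i \sum_k g k i by rewrite exchange_big.
have {}e : \sum_i \sum_k a i k = \sum_i \sum_k c i k + \sum_i \sum_k b i k.
  by apply/eqP; rewrite -subr_eq -subr_eq0 e gg subrr.
by rewrite e; ring.
Qed.

Variables (R : realType) (n : nat).
Local Notation C := (R[i]).
Local Notation iC := ('i%C : C).
Implicit Types (X Y xi eta : 'rV[R]_n -> 'rV[C]_n) (x : 'rV[R]_n).

Lemma pdC_mulmx Y (B : 'rV[R]_n -> 'M[C]_n) eta i j x :
  smooth_mx_at Y x -> smooth_mx_at eta x -> smooth_mx_at B x ->
  pdC (fun y => (eta y + Y y *m B y) 0 j) i x =
  pdC (fun y => eta y 0 j) i x +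
  \sum_k (Y x 0 k * pdC (fun y => B y k j) i x + pdC (fun y => Y y 0 k) i x * B x k j).
Proof.
move=> sY se sB; have [Pc PD PM] := smoothC_at_subring x.
have sYB k : smoothC_at (fun y => Y y 0 k * B y k j) x by exact: PM.
have sS : smoothC_at (fun y => \sum_k Y y 0 k * B y k j) x.
  exact: (fun_subring_sum (smoothC_at_subring x)).
rewrite (_ : (fun y => (eta y + Y y *m B y) 0 j) =
  fun y => eta y 0 j + \sum_k Y y 0 k * B y k j); last first.
  by apply/funext => y; rewrite !mxE.
rewrite pdCD // pdC_sum //; congr (_ + _); apply: eq_bigr => k _.
exact: pdCM.
Qed.

(* The cyclic hypothesis says that B is closed at x. *)
Lemma lie_cov_contract X Y xi eta (B : 'rV[R]_n -> 'M[C]_n) x :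
  smooth_mx_at X x -> smooth_mx_at Y x -> smooth_mx_at xi x -> smooth_mx_at eta x ->
  smooth_mx_at B x -> (forall y, (B y)^T = - B y) ->
  (forall i j k, pdC (fun y => B y j k) i x + pdC (fun y => B y k i) j x +
     pdC (fun y => B y i j) k x = 0) ->
  lie_cov X (fun y => eta y + Y y *m B y) x - contract_d Y (fun y => xi y + X y *m B y) x =
  lie_cov X eta x - contract_d Y xi x + lie_vec X Y x *m B x.
Proof.
move=> sX sY sxi seta sB skB cB; apply/rowP => j; rewrite !mxE.
have skE y k l : B y k l = - B y l k by have := skB y => /matrixP /(_ l k); rewrite !mxE.
have skd i k l : pdC (fun y => B y k l) i x = - pdC (fun y => B y l k) i x.
  have hl : smoothC_at (fun y => B y l k) x by exact: sB.
  have [Pc PD PM] := smoothC_at_subring x.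
  rewrite (_ : (fun y => B y k l) = fun y => -1 * B y l k).
    by rewrite pdCM // pdC_cst mul0r addr0 mulN1r.
  by apply/funext => y; rewrite mulN1r -skE.
under [X in X + _ = _]eq_bigr do rewrite pdC_mulmx // !mxE.
under [X in _ - X = _]eq_bigr do rewrite !pdC_mulmx //.
under [X in _ = _ + X]eq_bigr do rewrite !mxE.
rewrite (@courant_sum _ n (X x 0) (Y x 0) (eta x 0)
 (fun i k => pdC (fun y => X y 0 k) i x) (fun i k => pdC (fun y => Y y 0 k) i x)
 (fun i k => pdC (fun y => eta y 0 k) i x) (fun i k => pdC (fun y => xi y 0 k) i x)
 (fun k l => B x k l) (fun i k l => pdC (fun y => B y k l) i x)) //.
Qed.

Lemma lie_vec_near X X' Y Y' x : (\forall y \near x, X y = X' y) ->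
  (\forall y \near x, Y y = Y' y) -> lie_vec X Y x = lie_vec X' Y' x.
Proof.
move=> hX hY; apply/rowP => j; rewrite !mxE; apply: eq_bigr => i _.
rewrite (nbhs_singleton hX) (nbhs_singleton hY); congr (_ * _ - _ * _).
  by apply: pdC_near; apply: filterS hY => y ->.
by apply: pdC_near; apply: filterS hX => y ->.
Qed.

Lemma lie_cov_near X X' Y Y' x : (\forall y \near x, X y = X' y) ->
  (\forall y \near x, Y y = Y' y) -> lie_cov X Y x = lie_cov X' Y' x.
Proof.
move=> hX hY; apply/rowP => j; rewrite !mxE; apply: eq_bigr => i _.
rewrite (nbhs_singleton hX) (nbhs_singleton hY); congr (_ * _ + _ * _).
  by apply: pdC_near; apply: filterS hY => y ->.
by apply: pdC_near; apply: filterS hX => y ->.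
Qed.

Lemma contract_d_near X X' Y Y' x : (\forall y \near x, X y = X' y) ->
  (\forall y \near x, Y y = Y' y) -> contract_d X Y x = contract_d X' Y' x.
Proof.
move=> hX hY; apply/rowP => j; rewrite !mxE; apply: eq_bigr => i _.
rewrite (nbhs_singleton hX); congr (_ * (_ - _)).
  by apply: pdC_near; apply: filterS hY => y ->.
by apply: pdC_near; apply: filterS hY => y ->.
Qed.

Variable M : manifold R n.
Local Notation coord := (@Defs.coord R n M).

Lemma loc_form2_coord p (F : M -> 'M[R]_n) : loc_form2 p F (coord p p) = F p.
Proof. by rewrite /loc_form2 coordK ?trans_id ?trmx1 ?mul1mx ?mulmx1 //; exact: dom_refl. Qed.

(** The shear leaves vector parts unchanged, and with them the Lie bracket and the H-term; the
    covector part changes as in [lie_cov_contract], whose cyclic hypothesis is closedness of F. *)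
Lemma courant_shear (H : M -> 'I_n -> 'I_n -> 'I_n -> R) (u v : M -> 'rV[C]_(n + n))
    (F : M -> 'M[R]_n) p :
  closed_form2 F -> smooth_sec_at u p -> smooth_sec_at v p ->
  courant H (fun q => u q *m shear (iC *: cmx (F q))) (fun q => v q *m shear (iC *: cmx (F q))) p =
  courant H u v p *m shear (iC *: cmx (F p)).
Proof.
move=> cF su sv; rewrite /courant.
set x := coord p p.
pose B y := iC *: cmx (loc_form2 p F y).
have [_ sF dF] := cF p.
have hP := smoothC_at_subring x.
have sB : smooth_mx_at B x.
  apply: (mx_funZ hP (f := fun=> iC)); first by have [Pc _ _] := hP; exact: Pc.
  exact/smooth_mx_at_cmx.
have near_l w : \forall y \near x,
    lsubmx (loc_sec p (fun q => w q *m shear (iC *: cmx (F q))) y) = lsubmx (loc_sec p w y).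
  apply: filterS (near_chart (dom_refl p)) => y [h _].
  by rewrite loc_sec_shear // -{1}[loc_sec p w y]hsubmxK shearE row_mxKl.
have near_r w : \forall y \near x,
    rsubmx (loc_sec p (fun q => w q *m shear (iC *: cmx (F q))) y) =
    rsubmx (loc_sec p w y) + lsubmx (loc_sec p w y) *m B y.
  apply: filterS (near_chart (dom_refl p)) => y [h _].
  by rewrite loc_sec_shear // -{1}[loc_sec p w y]hsubmxK shearE row_mxKr.
rewrite (lie_vec_near (near_l u) (near_l v)) (lie_cov_near (near_l u) (near_r v)).
rewrite (contract_d_near (near_l v) (near_r u)).
pose HT (a b : 'rV[C]_n) : 'rV[C]_n := \row_k \sum_i \sum_j
  a 0 i * b 0 j * real_complex R (loc_form3 p H x i j k).
rewrite [X in row_mx _ (_ + X) = _](congr2 HT (nbhs_singleton (near_l u))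
  (nbhs_singleton (near_l v))).
have sl w : smooth_sec_at w p -> smooth_mx_at (fun y => lsubmx (loc_sec p w y)) x.
  by move=> sw i j; under eq_fun do rewrite mxE; exact: sw.
have sr w : smooth_sec_at w p -> smooth_mx_at (fun y => rsubmx (loc_sec p w y)) x.
  by move=> sw i j; under eq_fun do rewrite mxE; exact: sw.
rewrite (lie_cov_contract (sl _ su) (sl _ sv) (sr _ su) (sr _ sv) sB).
- by rewrite shearE /B loc_form2_coord [in RHS]addrAC.
- move=> y; rewrite /B [LHS]linearZ /= -cmx_tr -scalerN -cmxN; congr (_ *: cmx _).
  rewrite /loc_form2 !trmx_mul trmxK; have [-> _ _] := cF (param p y).
  by rewrite mulNmx mulmxN mulmxA.
- move=> i j k.
  have pdB a b c : pdC (fun y => B y b c) a x =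
      iC * real_complex R (pd (fun y => loc_form2 p F y b c) a x).
    have sbc : smoothC_at (fun y => real_complex R (loc_form2 p F y b c)) x.
      by have := (smooth_mx_at_cmx _ _).2 sF b c; under eq_fun do rewrite mxE.
    rewrite (_ : (fun y => B y b c) = fun y => iC * real_complex R (loc_form2 p F y b c)).
      by rewrite pdCM ?pdC_cst ?mul0r ?addr0 ?pdC_real //; have [Pc _ _] := hP; exact: Pc.
    by apply/funext => y; rewrite !mxE.
  by rewrite !pdB -!mulrDr -!rmorphD /= dF mulr0.
Qed.

Lemma closed_form2N (F : M -> 'M[R]_n) : closed_form2 F -> closed_form2 (fun q => - F q).
Proof.
move=> cF p; have [skF sF dF] := cF p.
have e i j : (fun x => loc_form2 p (fun q => - F q) x i j) =
    fun x => -1 * loc_form2 p F x i j.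
  by apply/funext => x; rewrite /loc_form2 mulmxN mulNmx mxE mulN1r.
have [Pc _ PM] := smooth_at_subring (coord p p).
split; first by rewrite linearN /= skF.
  by move=> i j; rewrite e; exact: PM.
have d i j k : pd (fun x => loc_form2 p (fun q => - F q) x j k) i (coord p p) =
    - pd (fun x => loc_form2 p F x j k) i (coord p p).
  by rewrite e pdM // pd_cst mulr0 addr0 mulN1r.
by move=> i j k; rewrite !d -!opprD dF oppr0.
Qed.

(** Sections of the sheared bundle are unsheared to sections of L, bracketed there, and sheared
    back. *)
Lemma involutive_def1 (H : M -> 'I_n -> 'I_n -> 'I_n -> R) (L : bundle M)
    (F : M -> 'M[R]_n) p :
  closed_form2 F -> involutive_at H L p -> involutive_at H (def1 F L) p.
Proof.
move=> cF iL u v su sv huv.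
have cFN := closed_form2N cF.
have sF q := let: And3 _ s _ := cFN q in s.
pose sh (w : M -> 'rV[C]_(n + n)) q := w q *m shear (iC *: cmx (- F q)).
have shK w : (fun q => sh w q *m shear (iC *: cmx (F q))) = w.
  by apply/funext => q; rewrite /sh -mulmxA cmxN scalerN shearNK mulmx1.
have su' : smooth_sec_at (sh u) p by apply: smooth_sec_shear.
have sv' : smooth_sec_at (sh v) p by apply: smooth_sec_shear.
rewrite -(shK u) -(shK v) courant_shear // /def1 expBE /= -mulmxA shearKN mulmx1.
apply: iL => //; apply: filterS huv => q; rewrite /def1 !expBE /= /sh cmxN scalerN.
by [].
Qed.

End CourantShear.

(** * Continuity of matrix-valued maps *)

Lemma continuous_mx (R : realType) (T : topologicalType) a b (f : T -> 'M[R]_(a, b)) t :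
  (forall i j, {for t, continuous (fun s => f s i j)}) -> {for t, continuous f}.
Proof.
move=> hf A [P hP PA]; rewrite /= nbhs_filterE.
have : \forall s \near t, forall i j, P i j (f s i j).
  apply: filter_forall => i; apply: filter_forall => j.
  exact: (hf i j _ (hP i j)).
by apply: filterS => s hs; apply: PA.
Qed.

(** Smoothness of the family F is stated jointly on R^(1+n); this carries time and chart coordinates
    there continuously. *)
Lemma continuous_row_mx (R : realType) (T : topologicalType) n (f : T -> R)
    (g : T -> 'rV[R]_n) t :
  {for t, continuous f} -> {for t, continuous g} ->
  {for t, continuous (fun s => row_mx (f s)%:M (g s) : 'rV[R]_(1 + n))}.
Proof.
move=> cf cg; apply: continuous_mx => i j; rewrite !ord1.
case: (fintype.splitP j) => k hk.
  have -> : j = lshift n k by apply: val_inj.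
  rewrite (_ : (fun _ => _) = f) //.
  by apply/funext => s; rewrite row_mxEl !ord1 mxE eqxx mulr1n.
have -> : j = rshift 1 k by apply: val_inj.
rewrite (_ : (fun _ => _) = fun s => g s 0 k); last first.
  by apply/funext => s; rewrite row_mxEr.
apply: (@continuous_comp _ _ _ g (fun v : 'rV[R]_n => v 0 k)) => //.
exact: coord_continuous.
Qed.

(** * The deformed pair as a generalized Kaehler structure *)

Section Deformation.
Variables (R : realType) (n : nat) (M : manifold R n).
Local Notation C := (R[i]).
Local Notation iC := ('i%C : C).
Local Notation coord := (@Defs.coord R n M).
Implicit Types (L : bundle M) (J : M -> 'M[R]_(n + n)) (F : M -> 'M[R]_n) (U : set M).

Lemma def1_eigD J L F p : twist_a (J p) (F p) \in unitmx -> L p = eigD J p ->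
  def1 F L p = eigD (fun q => twist (J q) (F q)) p.
Proof.
move=> u eL; rewrite /def1 expBE eL; apply/seteqP; split => v /=.
  by move=> /(twist_eigen v u).
by move=> /(twist_eigen v u).
Qed.

(** Openness of [U] spreads the invertibility of [twist_a] to a neighbourhood of each point, as
    [smooth_twist] demands. *)
Lemma gen_complex_twist (H : M -> 'I_n -> 'I_n -> 'I_n -> R) J L F U :
  gen_complex_on setT H J L -> closed_form2 F -> open U ->
  (forall p, U p -> twist_a (J p) (F p) \in unitmx) ->
  gen_complex_on U H (fun p => twist (J p) (F p)) (def1 F L).
Proof.
move=> [J2 sJ eL dL] cF oU uJ; split.
- by move=> p Up; apply: twist_sqr; [exact: uJ|exact: J2].
- move=> p Up; have [_ sF _] := cF p; apply: smooth_twist => //; first exact: sJ.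
  by apply: filterS (open_nbhs_nbhs (conj oU Up)) => q /uJ.
- by move=> p Up; apply: def1_eigD; [exact: uJ|exact: eL].
move=> p Up; have [sL mL iL] := dL p I; have [skF sF _] := cF p; split.
- exact: subbundle_def1.
- rewrite /def1 expBE; apply: maximal_isotropic_shear => //.
  by rewrite [LHS]linearZ /= -cmx_tr skF cmxN scalerN.
- exact: involutive_def1.
Qed.

Lemma orthogonal_twist (H : M -> 'I_n -> 'I_n -> 'I_n -> R) J L F p :
  gen_complex_on setT H J L -> closed_form2 F -> twist_a (J p) (F p) \in unitmx ->
  orthogonal_mx (twist (J p) (F p)).
Proof.
move=> [J2 sJ eL dL] cF uJ; have [_ [iL _] _] := dL p I; have [skF _ _] := cF p.
apply: orthogonal_isotropic; first exact: twist_sqr (J2 p I).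
move=> u v /(twist_eigen u uJ) hu /(twist_eigen v uJ) hv.
rewrite -(@pairing_shear _ _ (- (iC *: cmx (F p)))).
  by apply: iL; rewrite eL.
by rewrite linearN [X in - X]linearZ /= -cmx_tr skF cmxN scalerN.
Qed.

Lemma sqrN_unit m (J : 'M[R]_m) : J *m J = - 1%:M -> J \in unitmx.
Proof.
move=> J2; have [] // := @mulmx1_unit _ _ J (- J).
by rewrite mulmxN J2 opprK.
Qed.

(** Gram matrix, up to the factor 1/2, of the form <-J1 J2 u, u>; the order is reversed because
    matrices act on row vectors from the right. *)
Definition gk_form (J1 J2 : 'M[R]_(n + n)) := - (J2 *m J1 *m pairing_mx n R).

Lemma pairing_gk_form (J1 J2 : 'M[R]_(n + n)) (u : 'rV[R]_(n + n)) :
  pairing (- (u *m J2 *m J1)) u = 2^-1 * qf (gk_form J1 J2) u.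
Proof. by rewrite pairing_mxE /qf /gk_form mulmxN !mulNmx !mulmxA. Qed.

(** An orthogonal J with J^2 = -1 is skew for the pairing. Transposition moves two such factors
    across it, the signs cancel, and commutation restores the order. *)
Lemma gk_form_sym (J1 J2 : 'M[R]_(n + n)) :
  J1 *m J1 = - 1%:M -> J2 *m J2 = - 1%:M -> J1 *m J2 = J2 *m J1 ->
  orthogonal_mx J1 -> orthogonal_mx J2 -> (gk_form J1 J2)^T = gk_form J1 J2.
Proof.
move=> J11 J22 J12 o1 o2.
have skew (J : 'M[R]_(n + n)) : J *m J = - 1%:M -> orthogonal_mx J ->
    pairing_mx n R *m J^T = - (J *m pairing_mx n R).
  move=> J2' oJ; rewrite -[in RHS]oJ !mulmxA J2' mulNmx mul1mx mulNmx opprK.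
  by [].
rewrite /gk_form linearN /= !trmx_mul pairing_mx_tr mulmxA skew //.
by rewrite mulNmx -[J1 *m _ *m _]mulmxA (skew J2) // mulmxN opprK mulmxA J12.
Qed.

Lemma gk_form_unit (J1 J2 : 'M[R]_(n + n)) :
  J1 *m J1 = - 1%:M -> J2 *m J2 = - 1%:M -> gk_form J1 J2 \in unitmx.
Proof.
move=> /sqrN_unit u1 /sqrN_unit u2; rewrite /gk_form -mulNmx -mulNmx.
rewrite !unitmx_mul u1 andbT.
have [-> _] := mulmx1_unit (pairing_mx_sqr n R); rewrite andbT.
by rewrite -scaleN1r unitmxZ ?unitrN1.
Qed.

Lemma continuous_gk_form (T : topologicalType) (t : T) (A1 A2 : 'M[R]_(n + n))
    (F1 F2 : T -> 'M[R]_n) :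
  (forall i j, {for t, continuous (fun s => F1 s i j)}) ->
  (forall i j, {for t, continuous (fun s => F2 s i j)}) ->
  twist_a A1 (F1 t) \in unitmx -> twist_a A2 (F2 t) \in unitmx ->
  forall i j, {for t, continuous (fun s => gk_form (twist A1 (F1 s)) (twist A2 (F2 s)) i j)}.
Proof.
move=> c1 c2 u1 u2; have hP := @continuous_subring R T t.
have ca (A : 'M[R]_(n + n)) (G : T -> 'M[R]_n) :
    (forall i j, {for t, continuous (fun s => G s i j)}) ->
    mx_fun (fun f : T -> R => {for t, continuous f}) (fun s => twist_a A (G s)).
  move=> cG; apply: (mx_funD hP); first exact: mx_fun_cst.
  apply: (mx_funM hP); first exact: mx_fun_cst.
  by apply: mx_fun_block => //; exact: (mx_fun_cst hP).
have ct (A : 'M[R]_(n + n)) (G : T -> 'M[R]_n) :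
    (forall i j, {for t, continuous (fun s => G s i j)}) ->
    twist_a A (G t) \in unitmx ->
    mx_fun (fun f : T -> R => {for t, continuous f}) (fun s => twist A (G s)).
  move=> cG uG; apply: (mx_funM hP); last exact: ca.
  apply: (mx_funM hP); last exact: mx_fun_cst.
  apply: (mx_fun_inv (x0 := t) hP) => //; last exact: ca.
  by move=> f f0 cf; exact: continuousV.
apply: (mx_funN hP); apply: (mx_funM hP); last exact: mx_fun_cst.
by apply: (mx_funM hP); exact: ct.
Qed.

Lemma twist0 (A : 'M[R]_(n + n)) : twist A 0 = A.
Proof.
have a1 : twist_a A 0 = 1%:M.
  by rewrite /twist_a /nil_mx block_mx0 mulmx0 addr0.
by rewrite /twist a1 adjinvE ?unitmx1 // invmx1 mul1mx mulmx1.
Qed.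

Lemma continuous_family2 (F : R -> M -> 'M[R]_n) p (t : R) i j :
  smooth_family2 F -> {for t, continuous (fun s => F s p i j)}.
Proof.
move=> sF.
pose g (z : 'rV[R]_(1 + n)) := loc_form2 p (F (lsubmx z 0 0)) (rsubmx z) i j.
have gE : (fun s => F s p i j) = g \o (fun s : R => row_mx s%:M (coord p p)).
  apply/funext => s; have e : (s%:M : 'M[R]_1) 0 0 = s by rewrite mxE eqxx mulr1n.
  by rewrite /g /= row_mxKl row_mxKr e loc_form2_coord.
rewrite gE; apply: continuous_comp; last exact: smooth_at_cont (sF t p i j).
by apply: continuous_row_mx; [exact: cvg_id|exact: cst_continuous].
Qed.

(** The point p is fixed, so that commutation and positivity become statements about a path of
    matrices in one fibre, over an interval containing time 0. *)
Lemma deformation_pointwise (H : M -> 'I_n -> 'I_n -> 'I_n -> R) J1 J2 L1 L2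
    (Ip Im : M -> 'M[R]_n) (sp sm : M -> 'M[C]_n) (F : R -> M -> 'M[R]_n) (a b : R) p :
  gen_complex_on setT H J1 L1 -> gen_complex_on setT H J2 L2 ->
  (forall u : 'rV[R]_(n + n), u != 0 -> 0 < pairing (- (u *m J2 p *m J1 p)) u) ->
  L_hol Ip sp = sigma_plus L1 L2 ->
  holomorphic_poisson Im sm -> L_hol Im sm = sigma_minus L1 L2 ->
  smooth_family2 F -> (forall t, closed_form2 (F t)) -> F 0 p = 0 ->
  (forall t, is_holomorphic_poisson (expF (F t) (L_hol Ip sp))) ->
  a < 0 < b ->
  (forall s, a < s < b -> twist_a (J1 p) (F s p) \in unitmx /\
                          twist_a (J2 p) (- F s p) \in unitmx) ->
  forall t, a < t < b ->
  twist (J1 p) (F t p) *m twist (J2 p) (- F t p) =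
  twist (J2 p) (- F t p) *m twist (J1 p) (F t p) /\
  forall u : 'rV[R]_(n + n), u != 0 ->
    0 < pairing (- (u *m twist (J2 p) (- F t p) *m twist (J1 p) (F t p))) u.
Proof.
move=> gc1 gc2 pos hp [cm _ _ _] hm sF cF F0 hF ab0 uJ.
have [J11 _ e1 _] := gc1; have [J22 _ e2 _] := gc2.
have sq1 s : a < s < b -> twist (J1 p) (F s p) *m twist (J1 p) (F s p) = - 1%:M.
  by move=> /uJ [u1 _]; exact: twist_sqr (J11 p I).
have sq2 s : a < s < b -> twist (J2 p) (- F s p) *m twist (J2 p) (- F s p) = - 1%:M.
  by move=> /uJ [_ u2]; exact: twist_sqr (J22 p I).
have comm s : a < s < b -> twist (J1 p) (F s p) *m twist (J2 p) (- F s p) =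
    twist (J2 p) (- F s p) *m twist (J1 p) (F s p).
  move=> hs; have [u1 u2] := uJ s hs.
  (* Commutation at time s comes from the complex structure [I'] of the deformed holomorphic Poisson
     structure, together with the unchanged [Im]. *)
  have [I' [s' [[cI _ _ _] eI]]] := hF s.
  have [I2 _ _] := cI p; have [Im2 _ _] := cm p.
  have h1 : L_hol I' s' p = sigma_plus (def1 (F s) L1) (def1 (fun q => - F s q) L2) p.
    by rewrite -def2E sigma_plus_def -hp eI.
  have h2 : L_hol Im sm p = sigma_minus (def1 (F s) L1) (def1 (fun q => - F s q) L2) p.
    by rewrite -def2E sigma_minus_def -hm.
  exact: (commute_eig (J1 := fun q => twist (J1 q) (F s q))
    (J2 := fun q => twist (J2 q) (- F s q)) (sq1 s hs)
    (def1_eigD u1 (e1 p I)) (def1_eigD (F := fun q => - F s q) u2 (e2 p I)) I2 Im2 h1 h2).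
move=> t ht; split; first exact: comm.
pose S s := gk_form (twist (J1 p) (F s p)) (twist (J2 p) (- F s p)).
have : posdef (S t).
  apply: (@posdef_path _ _ S a b 0) ht => //.
  - move=> s hs; have [u1 u2] := uJ s hs; split; last exact: gk_form_unit (sq1 s hs) (sq2 s hs).
    apply: gk_form_sym; [exact: sq1|exact: sq2|exact: comm| |].
      exact: orthogonal_twist gc1 (cF s) u1.
    exact: (orthogonal_twist gc2 (closed_form2N (cF s)) u2).
  - move=> s hs; have [u1 u2] := uJ s hs.
    apply: (continuous_gk_form (F1 := fun s => F s p) (F2 := fun s => - F s p)) => //.
      by move=> i j; exact: continuous_family2.
    move=> i j; rewrite (_ : (fun _ => _) = fun r => - F r p i j); last first.
      by apply/funext => r; rewrite mxE.
    by apply: continuousN; exact: continuous_family2.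
  (* At time 0 both twists are trivial, and positivity is that of the given structure. *)
  - move=> u u0; rewrite /S F0 oppr0 !twist0.
    by have := pos u u0; rewrite pairing_gk_form pmulr_rgt0 ?invr_gt0.
by move=> pS u u0; rewrite pairing_gk_form pmulr_rgt0 ?invr_gt0 //; exact: pS.
Qed.

(** Stated over an open [U] to serve both conclusions: a neighbourhood of a compact set for small
    times, and all of M for the maximal interval. *)
Lemma deformation_on (H : M -> 'I_n -> 'I_n -> 'I_n -> R) J1 J2 L1 L2
    (Ip Im : M -> 'M[R]_n) (sp sm : M -> 'M[C]_n) (F : R -> M -> 'M[R]_n) (a b : R) U :
  gen_complex_on setT H J1 L1 -> gen_complex_on setT H J2 L2 ->
  (forall p, forall u : 'rV[R]_(n + n), u != 0 -> 0 < pairing (- (u *m J2 p *m J1 p)) u) ->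
  L_hol Ip sp = sigma_plus L1 L2 ->
  holomorphic_poisson Im sm -> L_hol Im sm = sigma_minus L1 L2 ->
  smooth_family2 F -> (forall t, closed_form2 (F t)) -> (forall p, F 0 p = 0) ->
  (forall t, is_holomorphic_poisson (expF (F t) (L_hol Ip sp))) ->
  a < 0 < b -> open U ->
  (forall s, a < s < b -> forall p, U p -> twist_a (J1 p) (F s p) \in unitmx /\
                          twist_a (J2 p) (- F s p) \in unitmx) ->
  forall t, a < t < b -> gen_kaehler_on U H (def1 (F t) L1) (def2 (F t) L2).
Proof.
move=> gc1 gc2 pos hp hlm hm sF cF F0 hF ab0 oU uJ t ht.
have pw p (Up : U p) := deformation_pointwise gc1 gc2 (pos p) hp hlm hm sF cF (F0 p) hF ab0
  (fun s hs => uJ s hs p Up) ht.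
exists (fun p => twist (J1 p) (F t p)), (fun p => twist (J2 p) (- F t p)); split.
- by apply: gen_complex_twist => // p Up; have [] := uJ t ht p Up.
- rewrite def2E; apply: (gen_complex_twist (F := fun p => - F t p)) => //.
    exact: closed_form2N.
  by move=> p Up; have [] := uJ t ht p Up.
- by move=> p /pw [].
- by move=> p /pw [].
Qed.

(** The determinant of [twist_a] is jointly continuous in time and chart coordinates and equals 1 at
    time 0. The constant [c] will be 1 for the first factor and -1 for the second. *)
Lemma near_twist_unit (F : R -> M -> 'M[R]_n) J (c : R) p :
  smooth_mx_at (loc_gend p J) (coord p p) -> smooth_family2 F -> F 0 p = 0 ->
  \forall t \near (0 : R) & q \near p, twist_a (J q) (c *: F t q) \in unitmx.
Proof.
move=> sJ sF F0; have pp := dom_refl p.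
pose Jh x := let q := param p x in gtrans p q q *m J q *m gtrans q p q.
have sJh : forall i j, smooth_at (fun x => Jh x i j) (coord p p).
  exact: (smooth_mx_at_cmx Jh (coord p p)).1 sJ.
pose x0 := coord p p.
pose A (y : R * 'rV[R]_n) := twist_a (Jh y.2) (c *: loc_form2 p (F y.1) y.2).
have hP := @continuous_subring R (R * 'rV[R]_n)%type (0, x0).
have cA : mx_fun (fun f : R * 'rV[R]_n -> R => {for (0, x0), continuous f}) A.
  apply: (mx_funD hP); first exact: mx_fun_cst.
  apply: (mx_funM hP).
    move=> i j; apply: (@continuous_comp _ _ _ snd (fun x => Jh x i j)).
      exact: cvg_snd.
    exact: smooth_at_cont (sJh i j).
  have h0 := mx_fun_cst hP (0 : 'M[R]_n).
  apply: mx_fun_block; [exact: h0| |exact: h0|exact: h0].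
  apply: (mx_funZ hP (f := fun=> c)); first by have [Pc _ _] := hP; exact: Pc.
  move=> i j.
  pose g (z : 'rV[R]_(1 + n)) := loc_form2 p (F (lsubmx z 0 0)) (rsubmx z) i j.
  have -> : (fun y : R * 'rV[R]_n => loc_form2 p (F y.1) y.2 i j) =
      g \o (fun y => row_mx (y.1)%:M y.2).
    apply/funext => y; have e : (y.1%:M : 'M[R]_1) 0 0 = y.1 by rewrite mxE eqxx mulr1n.
    by rewrite /g /= row_mxKl row_mxKr e.
  apply: continuous_comp; last exact: smooth_at_cont (sF 0 p i j).
  by apply: continuous_row_mx; [exact: cvg_fst|exact: cvg_snd].
have cdet := fun_subring_det hP cA.
have A0 : A (0, x0) = 1%:M.
  rewrite /A /= loc_form2_coord F0 scaler0.
  by rewrite /twist_a /nil_mx block_mx0 mulmx0 addr0.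
have : \forall y \near (0 : R, x0), \det (A y) != 0.
  have := cdet [set z | z != 0]; apply.
  apply: open_nbhs_nbhs; split; first exact: open_neq.
  by rewrite /= A0 det1 oner_neq0.
move=> [[V W] /= [hV hW] VW].
exists (V, [set q | dom p q /\ W (coord p q)]) => /=.
  split=> //; apply: filterI; first exact: near_dom.
  exact: (Defs.coord_continuous pp hW).
move=> [t q] /= [Vt [pq Wq]]; rewrite unitmxE unitfE.
have := VW (t, coord p q) (conj Vt Wq); rewrite /A /= /Jh coordK //.
have -> : c *: loc_form2 p (F t) (coord p q) =
    trans p q q *m (c *: F t q) *m (trans p q q)^T.
  by rewrite /loc_form2 coordK // -scalemxAr -scalemxAl.
(* The determinant does not depend on the frame, so the chart at p decides invertibility in the
   frame at q. *)
by rewrite det_twist_a_gtrans.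
Qed.

End Deformation.

(** * Uniform time bounds near a compact set *)

Section NearCompact.
Variables (R : realType) (n : nat) (M : manifold R n).

(** Each point of K has a product neighbourhood of invertibility in time and space; compactness
    extracts a common time bound. *)
Lemma compact_twist_unit (F : R -> M -> 'M[R]_n) (J1 J2 : M -> 'M[R]_(n + n)) (K : set M) :
  (forall p, smooth_mx_at (loc_gend p J1) (Defs.coord p p)) ->
  (forall p, smooth_mx_at (loc_gend p J2) (Defs.coord p p)) ->
  smooth_family2 F -> (forall p, F 0 p = 0) -> compact K ->
  exists (e : R) (U : set M), [/\ 0 < e, open U, K `<=` U &
    forall s, - e < s < e -> forall p, U p ->
      twist_a (J1 p) (F s p) \in unitmx /\ twist_a (J2 p) (- F s p) \in unitmx].
Proof.
move=> s1 s2 sF F0 /compact_near_coveringP cK.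
(* [Q e] covers all times in the interval at once, so that its interior can serve as the open set
   [U]. *)
pose Q (e : R) (q : M) := forall s, - e < s < e ->
  twist_a (J1 q) (F s q) \in unitmx /\ twist_a (J2 q) (- F s q) \in unitmx.
have : \forall e \near 0^'+, K `<=` (fun p => \forall q \near p, Q e q).
  apply: cK => p Kp.
  have [[V1 W1] /= [hV1 hW1] VW1] := near_twist_unit 1 (s1 p) sF (F0 p).
  have [[V2 W2] /= [hV2 hW2] VW2] := near_twist_unit (-1) (s2 p) sF (F0 p).
  have /nbhs_ballP [e0 /= e00 he0] : nbhs (0 : R) (V1 `&` V2) by exact: filterI.
  exists (interior (W1 `&` W2), [set e | 0 < e < e0]) => /=.
    split; first by apply: nbhs_interior; exact: filterI.
    by near=> e; apply/andP; split; near: e; [exact: nbhs_right_gt|exact: nbhs_right_lt].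
  move=> [q e] /= [Wq /andP[e_gt0 ee0]]; apply: filterS Wq => r [Wr1 Wr2] s hs.
  have [Vs1 Vs2] : (V1 `&` V2) s.
    apply: he0; rewrite /ball /= sub0r normrN ltr_norml.
    by move: hs => /andP [h1 h2]; apply/andP; split; lra.
  have := VW1 (s, r) (conj Vs1 Wr1); have := VW2 (s, r) (conj Vs2 Wr2).
  by rewrite /= scale1r scaleN1r.
move=> h; near (0 : R)^'+ => e.
exists e, (interior (Q e)); split.
- by near: e; exact: nbhs_right_gt.
- exact: open_interior.
- by near: e.
- by move=> s hs p /interior_subset; apply.
Unshelve. all: by end_near. Qed.

End NearCompact.

Theorem theorem4p8 (R : realType) (n : nat) (M : manifold R n)
  (H : M -> 'I_n -> 'I_n -> 'I_n -> R) (L1 L2 : bundle M)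
  (Iplus Iminus : M -> 'M[R]_n) (splus sminus : M -> 'M[R[i]]_n)
  (P1 P2 : M -> 'M[R]_n) (F : R -> M -> 'M[R]_n)
  (hH : closed_form3 H)
  (hL : gen_kaehler_on setT H L1 L2)
  (hp : holomorphic_poisson Iplus splus) (hLp : L_hol Iplus splus = sigma_plus L1 L2)
  (hm : holomorphic_poisson Iminus sminus) (hLm : L_hol Iminus sminus = sigma_minus L1 L2)
  (hP1 : real_poisson P1) (hLP1 : graphD P1 = real_part L1)
  (hP2 : real_poisson P2) (hLP2 : graphD P2 = real_part L2)
  (hFsmooth : smooth_family2 F)
  (hFclosed : forall t, closed_form2 (F t))
  (hF0 : forall p, F 0 p = 0)
  (hFhol : forall t, is_holomorphic_poisson (expF (F t) (L_hol Iplus splus))) :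
  [/\ forall K : set M, compact K ->
        exists (e : R) (U : set M), [/\ 0 < e, open U, K `<=` U &
          forall t, `|t| < e ->
            gen_kaehler_on U H (def1 (F t) L1) (def2 (F t) L2)],
      forall t, max_interval (fun s => one_plus_invertible (F s) P1 P2) t ->
        gen_kaehler_on setT H (def1 (F t) L1) (def2 (F t) L2)
    & forall t,
        sigma_plus (def1 (F t) L1) (def2 (F t) L2)
          = expF (F t) (L_hol Iplus splus) /\
        sigma_minus (def1 (F t) L1) (def2 (F t) L2) = L_hol Iminus sminus ].
Proof.
have [J1 [J2 [gc1 gc2 _ pos]]] := hL.
have [J11 s1 e1 _] := gc1; have [J22 s2 e2 _] := gc2.
have hp' : forall t, sigma_plus (def1 (F t) L1) (def2 (F t) L2)
    = expF (F t) (L_hol Iplus splus).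
  by move=> t; rewrite sigma_plus_def hLp.
(* The Poisson bivector is the lower-left block of J, so [det_twist_a] identifies invertibility of
   [twist_a] with that of [one_plus], taken with -F for the second factor. *)
have d1 p : P1 p = dlsubmx (J1 p).
  by apply: (graph_real_part (L := L1) (J11 p I) (e1 p I)); rewrite hLP1.
have d2 p : P2 p = dlsubmx (J2 p).
  by apply: (graph_real_part (L := L2) (J22 p I) (e2 p I)); rewrite hLP2.
have def_on := deformation_on gc1 gc2 (fun p => pos p I) hLp hm hLm hFsmooth hFclosed hF0 hFhol.
split.
- move=> K cK.
  have [e [U [e0 oU KU uU]]] := compact_twist_unit (fun p => s1 p I) (fun p => s2 p I)
    hFsmooth hF0 cK.
  exists e, U; split=> // t te; apply: (def_on (- e) e) => //.
    by rewrite oppr_lt0 e0.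
  by rewrite -ltr_norml.
- move=> t [a [b [a0 b0 tab uab]]]; apply: (def_on a b) => //; [by rewrite a0 b0|exact: openT|].
  move=> s /uab u p _; have [u1 u2] := u p.
  rewrite !unitmxE !det_twist_a -d1 -d2 -!unitmxE; split; [exact: u1|exact: u2].
- by move=> t; split; [exact: hp'|rewrite sigma_minus_def hLm].
Qed.
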